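(* Let $P\subset\mathbb{R}^d$ be a finite set of doubling dimension $\mathrm{ddim}(P)$, let $k\le|P|$, $z<|P|$ and $0<\epsilon<1/2$, and let $G\in\mathbb{R}^{t\times d}$ be a matrix of i.i.d. Gaussians $N(0,\tfrac1t)$ for a suitable $t=O(\tfrac{\log(kz)}{\epsilon^2}+\tfrac{\log(1/\epsilon)}{\epsilon^2}\mathrm{ddim}(P))$. Then with probability at least $2/3$: (1) the value of $k$-center with $z$ outliers of $G(P)$ is a $(1+\epsilon)$-approximation of the value of $k$-center with $z$ outliers of $P$; and (2) for every $\alpha\ge1$, every pair $C,Z\subset P$ with $|C|=k$, $|Z|\le z$ is an $\alpha(1+\epsilon)$-approximate solution of $k$-center with $z$ outliers for $P$ whenever $(G(C),G(Z))$ is an $\alpha$-approximate solution of $k$-center with $z$ outliers for $G(P)$.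
   Context: Euclidean norms. The doubling dimension $\mathrm{ddim}(P)$ is the smallest number such that every ball in $P$ (i.e., $P\cap B(x,r)$, $x\in P$) can be covered by $2^{\mathrm{ddim}(P)}$ balls in $P$ of half the radius. For a finite $X\subset\mathbb{R}^m$, $\mathrm{OPT}_{outliers}(X)$ is the minimum over $C\subset\mathbb{R}^m$, $|C|=k$, and $Z\subset X$, $|Z|\le z$, of $\max_{x\in X\setminus Z}\min_{c\in C}\|x-c\|$; a pair $(C,Z)$ is $\gamma$-approximate if this cost is at most $\gamma\,\mathrm{OPT}_{outliers}(X)$. ''$(1+\epsilon)$-approximation of the value'' means the values agree up to factor $1+\epsilon$. $G(X)=\{Gx:x\in X\}$. *)

(* Defs.v *)
From HB Require Import structures.
From mathcomp Require Import all_boot all_order all_algebra.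
From mathcomp Require Import all_classical all_reals all_analysis.
From mathcomp Require Import normal_distribution.
Set Implicit Arguments. Unset Strict Implicit. Unset Printing Implicit Defensive.
Import Order.TTheory GRing.Theory Num.Theory.
Local Open Scope classical_set_scope.
Local Open Scope ring_scope.

Section KCenter.
Variable R : realType.

Definition enorm (m : nat) (x : 'cV[R]_m) : R :=
  Num.sqrt (\sum_(i < m) (x i ord0) ^+ 2).
Definition edist (m : nat) (x y : 'cV[R]_m) : R := enorm (x - y).

Definition mindist (m : nat) (x : 'cV[R]_m) (C : seq 'cV[R]_m) : R :=
  match C with
  | [::] => 0
  | c :: C' => foldr (fun c' r => Num.min (edist x c') r) (edist x c) C'
  end.

(* cost of (C,Z) on X : max_{x in X \ Z} min_{c in C} ||x - c||
   (distances are >= 0, so 0 is a correct neutral element) *)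
Definition kc_cost (m : nat) (X C Z : seq 'cV[R]_m) : R :=
  \big[Num.max/0]_(x <- X | x \notin Z) mindist x C.

Definition opt_outliers (m : nat) (X : seq 'cV[R]_m) (k z : nat) : R :=
  inf [set r : R | exists C Z : seq 'cV[R]_m,
         [/\ uniq C /\ size C = k, uniq Z, ({subset Z <= X}), (size Z <= z)%N
          & r = kc_cost X C Z]].

Definition is_approx (m : nat) (X : seq 'cV[R]_m) (k z : nat) (gamma : R)
    (C Z : seq 'cV[R]_m) : Prop :=
  kc_cost X C Z <= gamma * opt_outliers X k z.

Definition doubling_bound (m : nat) (P : seq 'cV[R]_m) (D : R) : Prop :=
  forall (x : 'cV[R]_m) (r : R), x \in P -> 0 < r ->
    exists S : seq 'cV[R]_m,
      [/\ ({subset S <= P}), (size S)%:R <= 2 `^ D &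
          forall y, y \in P -> edist y x <= r ->
            exists2 s, s \in S & edist y s <= r / 2].

Definition ddim (m : nat) (P : seq 'cV[R]_m) : R :=
  inf [set D : R | 0 <= D /\ doubling_bound P D].

Definition img (t m : nat) (G : 'M[R]_(t, m)) (X : seq 'cV[R]_m) : seq 'cV[R]_t :=
  map (fun x => G *m x) X.

End KCenter.

(* G : 'I_t -> 'I_d -> Omega -> R is a matrix of i.i.d. N(0, 1/t) random
   variables (mean 0, standard deviation sqrt(1/t)) *)
Definition iid_gaussian_matrix {R : realType} {dsp : measure_display}
    {Omega : measurableType dsp} (Pr : probability Omega R) (t d : nat)
    (G : 'I_t -> 'I_d -> Omega -> R) : Prop :=
  [/\ (forall i j, measurable_fun setT (G i j)),
      (forall i j (B : set R), measurable B ->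
          Pr (G i j @^-1` B) = normal_prob 0 (Num.sqrt (t%:R^-1)) B) &
      (forall B : 'I_t -> 'I_d -> set R, (forall i j, measurable (B i j)) ->
          Pr [set w | forall i j, G i j w \in B i j] =
          (\prod_(i < t) \prod_(j < d) Pr (G i j @^-1` B i j))%E)].

Definition Gmat {R : realType} {Omega : Type} (t d : nat)
    (G : 'I_t -> 'I_d -> Omega -> R) (w : Omega) : 'M[R]_(t, d) :=
  \matrix_(i, j) G i j w.

(* Main.v *)
(** Write o for the optimum on P and e for a small multiple of eps. Up to z outliers,
    P is covered by k balls of radius about o, hence by at most
    k (1/e)^O(ddim P) + z points N of P at scale e o. Two events hold with high
    probability: G preserves all distances among N and the centers of a near-optimal
    solution up to 1 +- e (Johnson-Lindenstrauss), and every point of P within e o of a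
    point s of N has its image within 9 e o of G s (chaining along the doubling nets,
    which needs no bound on |P|). Since moreover G is almost surely injective on P,
    distances within P shrink at most by the factor 1 - e and the additive error O(e o).
    Applying G to the centers gives the upper bound on the optimum of G(P). For the
    lower bound, the centers in R^t of a clustering of G(P) are not images of points,
    but the inverse of G on N is 1/(1-e)-Lipschitz, so by Kirszbraun's theorem they pull
    back to centers in R^d. *)

Require Import Defs.
From HB Require Import structures.
From mathcomp Require Import all_boot all_order all_algebra.
From mathcomp Require Import all_classical all_reals all_analysis.
From mathcomp Require Import measurable_realfun normal_distribution.
From mathcomp Require Import ring lra.
(* mathcomp-analysis has its own [edist]; this makes [edist] the Euclidean distance. *)
Import Defs.
Import Order.TTheory GRing.Theory Num.Theory numFieldNormedType.Exports.
Local Open Scope classical_set_scope.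
Local Open Scope ring_scope.

(** * Gaussian integrals *)

(** The size of [t] is set by one union bound. Precise distance estimates are asked only of pairs
    from the net and the centers, a set fixed before [G] is drawn; the logarithm of its size is of
    order log(kz) + log(1/e) ddim P. A union bound over pairs of P would bring in log |P|. All other
    points carry an additive error O(e o), which is harmless because it is always compared with o,
    or with alpha o where alpha >= 1. When o = 0 this scale vanishes: P without its outliers then
    has at most k points and injectivity of G settles both claims.

    Independence is given on product sets only. Instead of invoking rotation invariance, the Laplace
    transform of |Gv|^2 is computed by integrating out one entry at a time, and all tail bounds
    follow from it.

    Kirszbraun's theorem enters as an intersection statement for balls of one common radius with
    some slack, which a variance argument proves from near-maximisers alone. *)

Section density.
Local Open Scope ereal_scope.
Context {d} {T : measurableType d} {R : realType}.
Variables (mu nu : {measure set T -> \bar R}) (p : T -> R).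
Hypothesis p0 : forall x, (0 <= p x)%R.
Hypothesis mp : measurable_fun setT p.
Hypothesis nuE : forall A, measurable A -> nu A = \int[mu]_(x in A) (p x)%:E.

Import HBNNSimple.

Lemma integral_density_nnsfun (g : {nnsfun T >-> R}) :
  \int[nu]_x (g x)%:E = \int[mu]_x ((g x)%:E * (p x)%:E).
Proof.
under [LHS]eq_integral do rewrite fimfunE -fsumEFin//.
rewrite [LHS]ge0_integral_fsum//; last 2 first.
  - by move=> r; exact/measurable_EFinP/measurableT_comp.
  - by move=> n x _; rewrite EFinM nnfun_muleindic_ge0.
under [RHS]eq_integral.
  move=> x xD; rewrite fimfunE -fsumEFin// muleC ge0_mule_fsumr; last first.
    by move=> r; rewrite EFinM nnfun_muleindic_ge0.
  over.
rewrite [RHS]ge0_integral_fsum//; last 2 first.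
  - move=> r; apply: emeasurable_funM; first exact/measurable_EFinP.
    exact/measurable_EFinP/measurableT_comp.
  - move=> n x _; apply: mule_ge0; first by rewrite lee_fin.
    by rewrite EFinM nnfun_muleindic_ge0.
apply: eq_fsbigr => r _.
have mr : measurable (g @^-1` [set r]) by [].
(* Scalars leave the integral only when nonnegative; a negative value has empty preimage. *)
have [r0|r0] := ltP r 0%R.
  rewrite preimage_nnfun0//.
  rewrite !integral0_eq// => x _; rewrite indicE in_set0 mulr0 ?mule0//.
under [RHS]eq_integral do rewrite EFinM muleCA.
under [LHS]eq_integral do rewrite EFinM.
rewrite !ge0_integralZl//; last 3 first.
- by apply: emeasurable_funM; exact/measurable_EFinP.
- by move=> x _; rewrite mule_ge0 ?lee_fin.
- exact/measurable_EFinP.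
congr (_ * _); rewrite integral_indic// setIT nuE// integral_mkcond.
apply: eq_integral => x _; rewrite patchE indicE.
by case: ifPn => /= _; rewrite ?mule1 ?mule0.
Qed.

Lemma integral_density (f : T -> \bar R) :
  measurable_fun setT f -> (forall x, 0 <= f x) ->
  \int[nu]_x f x = \int[mu]_x (f x * (p x)%:E).
Proof.
move=> mf f0.
pose f_ := nnsfun_approx measurableT mf.
transitivity (limn (fun n => \int[nu]_x (f_ n x)%:E)).
  rewrite -monotone_convergence//=.
  - apply: eq_integral => ? _; apply/esym/cvg_lim => //=.
    exact: cvg_nnsfun_approx.
  - by move=> n; exact/measurable_EFinP/measurable_funTS.
  - by move=> n ? _; rewrite lee_fin.
  - by move=> ? _ ? ? mn; rewrite lee_fin; exact/lefP/nd_nnsfun_approx.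
transitivity (limn (fun n => \int[mu]_x ((f_ n x)%:E * (p x)%:E))).
  by apply: congr_lim; apply/funext => n /=; exact: integral_density_nnsfun.
rewrite -monotone_convergence//=.
- apply: eq_integral => x _; apply/cvg_lim => //=.
  by apply: cvgeZr => //; exact: cvg_nnsfun_approx.
- move=> n; apply: emeasurable_funM; last exact/measurable_EFinP.
  exact/measurable_EFinP/measurable_funTS.
- by move=> n x _; rewrite mule_ge0 ?lee_fin.
- move=> x _ m n mn; rewrite lee_wpmul2r ?lee_fin//.
  exact/lefP/nd_nnsfun_approx.
Qed.

End density.

(** Completing the square: the tilted density is again Gaussian up to a constant, and that constant
    is the value of the integral below. Assuming [0 < k] rather than [0 <= lam] admits the slightly
    negative [lam] of the upper tail. *)
Lemma normal_pdf_tilt (R : realType) (sigma lam s a x : R)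
    (k := 1 + 2 * lam * s ^+ 2 * sigma ^+ 2) : sigma != 0 -> 0 < k ->
  expR (- lam * (a + s * x) ^+ 2) * normal_pdf 0 sigma x =
  (Num.sqrt k)^-1 * expR (- (lam / k) * a ^+ 2) *
  normal_pdf (- (2 * lam * a * s * sigma ^+ 2 / k)) (sigma / Num.sqrt k) x.
Proof.
move=> s0 k0; have sk0 : Num.sqrt k != 0 by rewrite sqrtr_eq0 -ltNge.
have s'0 : sigma / Num.sqrt k != 0 by rewrite mulf_neq0// invr_neq0.
have s'2 : (sigma / Num.sqrt k) ^+ 2 = sigma ^+ 2 / k.
  by rewrite expr_div_n sqr_sqrtr// ltW.
rewrite !normal_pdfE// /normal_peak /normal_fun s'2.
have -> : sigma ^+ 2 / k * pi *+ 2 = k^-1 * (sigma ^+ 2 * pi *+ 2).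
  by rewrite -mulrnAr; field; rewrite gt_eqF.
rewrite sqrtrM ?invr_ge0 ?(ltW k0)// sqrtrV ?(ltW k0)// invfM invrK.
set q := (Num.sqrt (_ *+ 2))^-1.
have E : - lam * (a + s * x) ^+ 2 + - (x - 0) ^+ 2 / (sigma ^+ 2 *+ 2) =
    - (lam / k) * a ^+ 2 + - (x - - (2 * lam * a * s * sigma ^+ 2 / k)) ^+ 2 /
        (sigma ^+ 2 / k *+ 2).
  rewrite subr0.
  have kn0 : 1 + 2 * lam * s ^+ 2 * sigma ^+ 2 != 0 by rewrite gt_eqF.
  by rewrite /k; field; rewrite kn0 s0.
move/(congr1 expR): E; rewrite !expRD => E.
rewrite mulrCA E [RHS]mulrACA; congr (_ * _).
by rewrite mulrA mulVf// mul1r.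
Qed.

Lemma integral_normal_expR_sqr (R : realType) (sigma lam s a : R) :
  sigma != 0 -> 0 < 1 + 2 * lam * s ^+ 2 * sigma ^+ 2 ->
  (\int[normal_prob 0 sigma]_x (expR (- lam * (a + s * x) ^+ 2))%:E =
   ((Num.sqrt (1 + 2 * lam * s ^+ 2 * sigma ^+ 2))^-1 *
    expR (- (lam / (1 + 2 * lam * s ^+ 2 * sigma ^+ 2)) * a ^+ 2))%:E)%E.
Proof.
move=> s0; set k := (1 + _)%R => k0.
pose m := - (2 * lam * a * s * sigma ^+ 2 / k).
pose sigma' := sigma / Num.sqrt k.
rewrite (@integral_density _ _ _ lebesgue_measure (normal_prob 0 sigma)
  (normal_pdf 0 sigma))//.
- pose c := ((Num.sqrt k)^-1 * expR (- (lam / k) * a ^+ 2)).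
  transitivity (\int[lebesgue_measure]_x (c%:E * (normal_pdf m sigma' x)%:E))%E.
    apply: eq_integral => x _; rewrite -!EFinM; congr EFin.
    exact: normal_pdf_tilt.
  rewrite ge0_integralZl//.
  + by rewrite integral_normal_pdf mule1.
  + apply/measurable_EFinP; exact: measurable_normal_pdf.
  + by move=> x _; rewrite lee_fin normal_pdf_ge0.
  + by rewrite lee_fin mulr_ge0 ?expR_ge0// invr_ge0 sqrtr_ge0.
- by move=> x; exact: normal_pdf_ge0.
- exact: measurable_normal_pdf.
- apply/measurable_EFinP; apply: measurableT_comp => //.
  apply: measurable_funM => //; apply: measurable_funX.
  by apply: measurable_funD => //; exact: measurable_funM.
Qed.

(** * Independence *)

Section independence.
Local Open Scope ereal_scope.
Context {R : realType} {d0} {Omega : measurableType d0} (Pr : probability Omega R).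

(** The single identity says both that the family is mutually independent (take [A] to be
    everything) and that it is independent of [Y]. The explicit list lets variables move into [Y]
    one at a time. *)
Definition indep {d} {T : measurableType d} {I : eqType}
    (Y : Omega -> T) (X : I -> Omega -> R) (l : seq I) :=
  forall (A : set T) (B : I -> set R), measurable A -> (forall i, measurable (B i)) ->
  Pr (Y @^-1` A `&` \big[setI/setT]_(i <- l) (X i @^-1` B i)) =
  Pr (Y @^-1` A) * \prod_(i <- l) Pr (X i @^-1` B i).

Lemma measurable_bigsetI {I : Type} (l : seq I) (F : I -> set Omega) :
  (forall i, measurable (F i)) -> measurable (\big[setI/setT]_(i <- l) F i).
Proof. by move=> mF; elim/big_ind : _ => // *; exact: measurableI. Qed.

Lemma measurable_preimageT {d} {T : measurableType d} (f : Omega -> T) A :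
  measurable_fun setT f -> measurable A -> measurable (f @^-1` A).
Proof. by move=> mf mA; rewrite -[X in measurable X]setTI; exact: mf. Qed.

(** As functions of the set [A] of pairs, both sides are finite measures. They agree on rectangles,
    a generating class stable under intersection, hence everywhere. *)
Lemma indep_cons {d} {T : measurableType d} {I : eqType}
    (Y : Omega -> T) (X : I -> Omega -> R) (p : I) (l : seq I) :
  measurable_fun setT Y -> (forall i, measurable_fun setT (X i)) ->
  uniq (p :: l) -> indep Y X (p :: l) ->
  indep (fun w => (Y w, X p w)) X l.
Proof.
move=> mY mX /= /andP[pl ul] ind A B mA mB.
have mYX : measurable_fun setT (fun w => (Y w, X p w)).
  exact/measurable_fun_pair.
set D := \big[setI/setT]_(i <- l) _.
have mD : measurable D.
  by apply: measurable_bigsetI => i; exact: measurable_preimageT.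
pose c := \prod_(i <- l) Pr (X i @^-1` B i).
have c0 : 0 <= c by apply: prode_ge0 => i _; exact: measure_ge0.
have cfin : c \is a fin_num.
  rewrite /c; elim/big_ind : _ => [//|x y|i _]; first exact: fin_numM.
  by apply: fin_num_measure; exact: measurable_preimageT.
pose r : {nonneg R} := NngNum (fine_ge0 c0).
pose m1 := measure_function_pushforward__canonical__measure_function_Measure
  (mrestr Pr mD) mYX.
pose m2 := mscale r
  (measure_function_pushforward__canonical__measure_function_Measure Pr mYX).
have m1E E : m1 E = Pr ((fun w => (Y w, X p w)) @^-1` E `&` D) by [].
have m2E E : m2 E = c * Pr ((fun w => (Y w, X p w)) @^-1` E).
  by rewrite /m2 /mscale /= fineK.
rewrite -m1E muleC -m2E.
pose C : set (set (T * R)) :=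
  [set C | exists A, measurable A /\ exists B, measurable B /\ C = A `*` B].
apply: (measure_unique C (fun=> setT)) => //.
- rewrite measurable_prod_measurableType //; congr (<<s _ >>).
  rewrite predeqE; split => [[A' mA' [B' mB' <-]]|[A' [mA' [B' [mB' ->]]]]].
    by exists A'; split => //; exists B'.
  by exists A' => //; exists B'.
- move=> /= _ _ [X1 [mX1 [X2 [mX2 ->]]]] [Y1 [mY1 [Y2 [mY2 ->]]]].
  rewrite -setXI; exists (X1 `&` Y1); split; first exact: measurableI.
  by exists (X2 `&` Y2); split => //; exact: measurableI.
- by move=> _; exists setT; split => //; exists setT; split => //; rewrite setXTT.
- by rewrite bigcup_const.
- move=> _ [A1 [mA1 [A2 [mA2 ->]]]].
  rewrite m1E; transitivity (m2 (A1 `*` A2)); last by []; rewrite m2E.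
  have Eset : (fun w => (Y w, X p w)) @^-1` (A1 `*` A2) =
    Y @^-1` A1 `&` X p @^-1` A2 by [].
  rewrite Eset.
  (* Two instances of the hypothesis: [B1] gives the rectangle together with the remaining
     variables, [B2] the rectangle alone; the factor [c] is what distinguishes them. *)
  pose B1 i := if i == p then A2 else B i.
  pose B2 i := if i == p then A2 else setT.
  have mB1 i : measurable (B1 i) by rewrite /B1; case: ifP.
  have mB2 i : measurable (B2 i) by rewrite /B2; case: ifP.
  have := ind A1 B1 mA1 mB1; have := ind A1 B2 mA1 mB2.
  rewrite !big_cons /B1 /B2 eqxx.
  have li i : i \in l -> (i == p) = false.
    by move=> il; apply: contraNF pl => /eqP <-.
  have -> : \big[setI/setT]_(j <- l) (X j @^-1` (if j == p then A2 else setT)) = setT.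
    rewrite (eq_big_seq (fun=> setT)) ?big1_eq// => i /li ->.
    exact: preimage_setT.
  have -> : \prod_(j <- l) Pr (X j @^-1` (if j == p then A2 else setT)) = 1.
    rewrite (eq_big_seq (fun=> 1)) ?big1_eq// => i /li ->.
    by rewrite preimage_setT probability_setT.
  have -> : \big[setI/setT]_(j <- l) (X j @^-1` (if j == p then A2 else B j)) = D.
    by apply: eq_big_seq => i /li ->.
  have -> : \prod_(j <- l) Pr (X j @^-1` (if j == p then A2 else B j)) = c.
    by apply: eq_big_seq => i /li ->.
  rewrite setIT mule1 => e1 e2.
  by rewrite -setIA e2 e1 [RHS]muleC muleA.
- by move=> _; rewrite m1E (le_lt_trans (probability_le1 Pr _)) ?ltry//;
    apply: measurableI => //; exact: measurable_preimageT.
Qed.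

(** The law of the pair is a product measure, so Tonelli integrates [X] out with [Y] frozen. *)
Lemma indep_integral {d d'} {T : measurableType d} {T' : measurableType d'}
    (Y : Omega -> T) (X : Omega -> T') (nu : probability T' R)
    (F : T * T' -> \bar R) :
  measurable_fun setT Y -> measurable_fun setT X ->
  (forall B, measurable B -> Pr (X @^-1` B) = nu B) ->
  (forall A B, measurable A -> measurable B ->
     Pr (Y @^-1` A `&` X @^-1` B) = Pr (Y @^-1` A) * Pr (X @^-1` B)) ->
  measurable_fun setT F -> (forall z, 0 <= F z) ->
  \int[Pr]_w F (Y w, X w) = \int[Pr]_w \int[nu]_x F (Y w, x).
Proof.
move=> mY mX Xnu ind mF F0.
have mYX : measurable_fun setT (fun w => (Y w, X w)).
  exact/measurable_fun_pair.
pose Yf : {mfun Omega >-> T} := HB.pack Y (isMeasurableFun.Build _ _ _ _ _ mY).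
pose YXf : {mfun Omega >-> (T * T')%type} :=
  HB.pack (fun w => (Y w, X w)) (isMeasurableFun.Build _ _ _ _ _ mYX).
transitivity (\int[distribution Pr YXf]_z F z).
  by rewrite ge0_integral_pushforward//.
transitivity (\int[distribution Pr Yf \x nu]_z F z).
  apply: eq_measure_integral => A mA _; apply/esym.
  apply: product_measure_unique => // B C mB mC.
  rewrite /distribution /pushforward /= -Xnu// -ind//.
rewrite fubini_tonelli1//= /fubini_F ge0_integral_pushforward//.
- exact: measurable_fun_fubini_tonelli_F.
- by move=> y _; exact: integral_ge0.
Qed.

End independence.

Section gaussian_family.
Context {R : realType} {d0} {Omega : measurableType d0} (Pr : probability Omega R).
Context {I : eqType} (X : I -> Omega -> R).
Hypothesis mX : forall i, measurable_fun setT (X i).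

Definition joint_product (l : seq I) :=
  forall B : I -> set R, (forall i, measurable (B i)) ->
  Pr (\big[setI/setT]_(i <- l) (X i @^-1` B i)) =
  (\prod_(i <- l) Pr (X i @^-1` B i))%E.

Lemma joint_product_belast (l : seq I) (p : I) :
  uniq (rcons l p) -> joint_product (rcons l p) -> joint_product l.
Proof.
rewrite rcons_uniq => /andP[pl ul] H B mB.
have li i : i \in l -> (i == p) = false.
  by move=> il; apply: contraNF pl => /eqP <-.
have := H (fun i => if i == p then setT else B i).
rewrite -cats1 !big_cat !big_seq1 /= eqxx preimage_setT setIT probability_setT mule1.
have -> : \big[setI/setT]_(j <- l) (X j @^-1` (if j == p then setT else B j)) =
    \big[setI/setT]_(j <- l) (X j @^-1` B j).
  by apply: eq_big_seq => i /li ->.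
have -> : (\prod_(j <- l) Pr (X j @^-1` (if j == p then setT else B j)) =
    \prod_(j <- l) Pr (X j @^-1` B j))%E.
  by apply: eq_big_seq => i /li ->.
by apply=> i; case: ifP.
Qed.

(* A measurable [Y] through which the variables indexed by [l1] factor plays the
   role of the sigma-algebra they generate. *)
Lemma indep_split (l1 l2 : seq I) : uniq (l1 ++ l2) -> joint_product (l1 ++ l2) ->
  exists d (T : measurableType d) (Y : Omega -> T) (f : I -> T -> R),
  [/\ measurable_fun setT Y, forall i, measurable_fun setT (f i),
      {in l1, forall i w, X i w = f i (Y w)} & indep Pr Y X l2].
Proof.
elim/last_ind: l1 l2 => [|l1 p IH] l2 ul jl.
  exists _, R, (fun=> 0), (fun _ _ => 0); split => // A B mA mB.
  rewrite -/(cst 0) preimage_cst; case: ifPn => _.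
    by rewrite setTI probability_setT mul1e; exact: jl.
  by rewrite set0I measure0 mul0e.
rewrite cat_rcons in ul jl.
have [d [T [Y [f [mY mf fX iY]]]]] := IH _ ul jl.
exists _, (T * R)%type, (fun w => (Y w, X p w)),
  (fun i z => if i == p then z.2 else f i z.1); split.
- exact/measurable_fun_pair.
- move=> i /=; case: (i == p); first exact: measurable_snd.
  exact: (measurableT_comp (mf i) measurable_fst).
- move=> i; rewrite mem_rcons inE => /predU1P[->|il] w; first by rewrite eqxx.
  case: eqP => [ip|_] /=; last exact: fX.
  by move: ul; rewrite cat_uniq /= -ip il /= andbF.
- move: ul; rewrite cat_uniq => /and3P[_ _ ul].
  exact: indep_cons.
Qed.

Section mgf.
Variables (t : nat) (row : I -> 'I_t) (a : I -> R) (sigma : R).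
Hypothesis s0 : sigma != 0.
Hypothesis Xlaw : forall i B, measurable B -> Pr (X i @^-1` B) = normal_prob 0 sigma B.

(** The entries of all rows sit in one list, [row] telling which coordinate an entry feeds. On the
    full list this is coordinate [i] of the image of the vector [a], and [rowsqr] is the squared
    norm of [a]. *)
Definition rowsum (x : I -> R) (l : seq I) (i : 'I_t) : R :=
  \sum_(p <- l | row p == i) a p * x p.
Definition rowsqr (l : seq I) (i : 'I_t) : R :=
  \sum_(p <- l | row p == i) a p ^+ 2.

Lemma rowsum_rcons x l p i : rowsum x (rcons l p) i =
  rowsum x l i + (if row p == i then a p * x p else 0).
Proof. by rewrite /rowsum big_rcons/=; case: ifP; rewrite ?addr0. Qed.

Lemma rowsqr_rcons l p i : rowsqr (rcons l p) i =
  rowsqr l i + (if row p == i then a p ^+ 2 else 0).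
Proof. by rewrite /rowsqr big_rcons/=; case: ifP; rewrite ?addr0. Qed.

Lemma rowsqr_ge0 l i : 0 <= rowsqr l i.
Proof. by apply: sumr_ge0 => p _; exact: sqr_ge0. Qed.

(* The last variable is integrated out by completing the square, which divides the
   [lam] of its row by [1 + 2 lam a^2 sigma^2]. *)
Lemma gaussian_rows_mgf (l : seq I) (lam : 'I_t -> R) :
  uniq l -> joint_product l ->
  (forall i, 0 < 1 + 2 * lam i * sigma ^+ 2 * rowsqr l i) ->
  (\int[Pr]_w (expR (\sum_(i < t) - lam i * rowsum (X ^~ w) l i ^+ 2))%:E =
   (\prod_(i < t) (Num.sqrt (1 + 2 * lam i * sigma ^+ 2 * rowsqr l i))^-1)%:E)%E.
Proof.
elim/last_ind: l lam => [|l p IH] lam ul jl lam0.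
  rewrite [X in _ = X%:E]big1 => [|i _]; last first.
    by rewrite /rowsqr big_nil mulr0 addr0 sqrtr1 invr1.
  under eq_integral => w _.
    rewrite big1 => [|i _]; last by rewrite /rowsum big_nil expr0n mulr0.
    rewrite expR0; over.
  by rewrite integral_cst//= probability_setT mule1.
have jl' := joint_product_belast _ _ ul jl.
have ul' : uniq l by move: ul; rewrite rcons_uniq => /andP[].
rewrite -cats1 in ul jl.
have [d [T [Y [f [mY mf fX iY]]]]] := indep_split _ _ ul jl.
pose i0 := row p.
pose k := 1 + 2 * lam i0 * a p ^+ 2 * sigma ^+ 2.
have V0 := rowsqr_ge0 l i0.
have lam0' : 0 < k + 2 * lam i0 * sigma ^+ 2 * rowsqr l i0.
  have := lam0 i0; rewrite rowsqr_rcons eqxx /k.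
  by congr (_ < _); ring.
(* For [lam >= 0] this is automatic; for negative [lam] the condition on the whole row is the
   stronger one. *)
have k0 : 0 < k.
  have [l0|l0] := leP 0 (lam i0).
    rewrite /k ltr_pwDl//; have : 0 <= (a p * sigma) ^+ 2 := sqr_ge0 _.
    by nra.
  apply: (lt_le_trans lam0'); rewrite gerDl.
  have : 0 <= sigma ^+ 2 * rowsqr l i0 by rewrite mulr_ge0 ?sqr_ge0.
  by nra.
(* With V the previous [rowsqr] of the row, k (1 + 2 (lam / k) sigma^2 V) = 1 + 2 lam sigma^2 (V +
   a_p^2), so the factors recombine at the end. *)
pose lam' i := if i == i0 then lam i / k else lam i.
have lam'0 i : 0 < 1 + 2 * lam' i * sigma ^+ 2 * rowsqr l i.
  rewrite /lam'; case: eqP => [->|/eqP ii0].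
    rewrite -(pmulr_rgt0 _ k0); move: lam0'; congr (_ < _).
    by field; rewrite gt_eqF.
  by have := lam0 i; rewrite rowsqr_rcons eq_sym (negbTE ii0) addr0.
pose s i y := rowsum (fun p => f p y) l i.
have sE i w : s i (Y w) = rowsum (X ^~ w) l i.
  rewrite /s /rowsum [LHS]big_seq_cond [RHS]big_seq_cond.
  by apply: eq_bigr => q /andP[ql _]; rewrite fX.
have ms i : measurable_fun setT (s i).
  rewrite /s /rowsum.
  under eq_fun do rewrite big_mkcond.
  apply: measurable_sum => q; case: (row q == i) => //.
  exact: measurable_funM.
pose F z := (expR (\sum_(i < t | i != i0) - lam i * s i z.1 ^+ 2) *
   expR (- lam i0 * (s i0 z.1 + a p * z.2) ^+ 2))%:E.
transitivity (\int[Pr]_w F (Y w, X p w))%E.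
  apply: eq_integral => w _; rewrite /F -expRD; congr (expR _)%:E.
  rewrite (bigD1 i0)//= addrC rowsum_rcons eqxx sE; congr (_ + _).
  by apply: eq_bigr => i ii0; rewrite rowsum_rcons eq_sym (negbTE ii0) addr0 sE.
rewrite (@indep_integral _ _ _ _ _ _ _ (measurableTypeR R) Y (X p) (normal_prob 0 sigma))//.
- transitivity (\int[Pr]_w (((Num.sqrt k)^-1)%:E *
    (expR (\sum_(i < t) - lam' i * rowsum (X ^~ w) l i ^+ 2))%:E))%E.
    apply: eq_integral => w _.
    rewrite /F /=; under eq_integral do rewrite EFinM.
    rewrite ge0_integralZl//; last first.
      apply/measurable_EFinP; apply: measurableT_comp => //.
      apply: measurable_funM => //; apply: measurable_funX.
      by apply: measurable_funD => //; exact: measurable_funM.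
    rewrite integral_normal_expR_sqr// -!EFinM mulrCA -expRD; congr (_ * expR _)%:E.
    rewrite [RHS](bigD1 i0)//= addrC /lam' eqxx sE; congr (_ + _).
    by apply: eq_bigr => i /negbTE ->; rewrite sE.
  rewrite ge0_integralZl//; last first.
    apply/measurable_EFinP; apply: measurableT_comp => //.
    apply: measurable_sum => i; apply: measurable_funM => //.
    apply: measurable_funX; rewrite /rowsum; under eq_fun do rewrite big_mkcond.
    apply: measurable_sum => q; case: (row q == i) => //.
    exact: measurable_funM.
  rewrite IH// -EFinM; congr EFin.
  rewrite (bigD1 i0)//= [RHS](bigD1 i0)//= mulrA; congr (_ * _).
    rewrite /lam' eqxx -invfM -sqrtrM ?(ltW k0)// rowsqr_rcons eqxx.
    by congr (Num.sqrt _)^-1; rewrite /k; field; rewrite -/k gt_eqF.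
  apply: eq_bigr => i ii0; rewrite /lam' (negbTE ii0) rowsqr_rcons.
  by rewrite eq_sym (negbTE ii0) addr0.
- exact: mX.
- exact: Xlaw.
- move=> A B mA mB; have := iY A (fun=> B) mA (fun=> mB).
  by rewrite !big_seq1.
- apply/measurable_EFinP; apply: measurable_funM.
  + apply: measurableT_comp => //; under eq_fun do rewrite big_mkcond.
    apply: measurable_sum => i; case: (i != i0) => //.
    apply: measurable_funM => //; apply: measurable_funX.
    exact: (measurableT_comp (ms i) measurable_fst).
  + apply: measurableT_comp => //.
    apply: measurable_funM => //; apply: measurable_funX.
    apply: measurable_funD.
      exact: (measurableT_comp (ms i0) measurable_fst).
    by apply: measurable_funM => //; exact: measurable_snd.
- by move=> z; rewrite lee_fin mulr_ge0 ?expR_ge0.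
Qed.

End mgf.
End gaussian_family.

(** * Tails of the norm of a Gaussian image *)

Section norm.
Context {R : realType}.

Lemma enorm_ge0 {m} (x : 'cV[R]_m) : 0 <= enorm x.
Proof. exact: sqrtr_ge0. Qed.

Lemma enorm_sqr {m} (x : 'cV[R]_m) : enorm x ^+ 2 = \sum_(i < m) x i ord0 ^+ 2.
Proof. by rewrite sqr_sqrtr// sumr_ge0// => i _; exact: sqr_ge0. Qed.

Lemma enorm0 {m} : enorm (0 : 'cV[R]_m) = 0.
Proof. by rewrite /enorm big1 ?sqrtr0// => i _; rewrite mxE expr0n. Qed.

Lemma enorm_eq0 {m} (x : 'cV[R]_m) : (enorm x == 0) = (x == 0).
Proof.
apply/eqP/eqP => [x0|->]; last exact: enorm0.
have := enorm_sqr x; rewrite x0 expr0n/= => /esym/eqP.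
rewrite psumr_eq0 => [/allP x20|i _]; last exact: sqr_ge0.
apply/matrixP => i j; rewrite (ord1 j) mxE; apply/eqP.
by rewrite -sqrf_eq0; apply: x20; rewrite mem_index_enum.
Qed.
End norm.

Section gaussian_matrix.
Context {R : realType} {d0} {Omega : measurableType d0} (Pr : probability Omega R).
Context {t d : nat} (G : 'I_t -> 'I_d -> Omega -> R).
Hypothesis t0 : (0 < t)%N.
Hypothesis iidG : iid_gaussian_matrix Pr G.
Implicit Type v : 'cV[R]_d.

Lemma measurable_enorm_Gmat v :
  measurable_fun setT (fun w => enorm (Gmat G w *m v)).
Proof.
have [mG _ _] := iidG.
rewrite /enorm; apply: measurableT_comp => //.
  by apply: continuous_measurable_fun; exact: sqrt_continuous.
apply: measurable_sum => i; apply: measurable_funX.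
under eq_fun do rewrite mxE.
apply: measurable_sum => j; under eq_fun do rewrite mxE.
exact: measurable_funM.
Qed.

Lemma iid_joint_product :
  joint_product Pr (fun p : 'I_t * 'I_d => G p.1 p.2) (index_enum _).
Proof.
have [_ _ indG] := iidG; move=> B mB.
transitivity (\prod_(i < t) \prod_(j < d) Pr (G i j @^-1` B (i, j)))%E; last first.
  by rewrite pair_bigA; apply: eq_bigr => -[].
rewrite -indG//; congr (Pr _).
rewrite -bigcap_seq; apply/seteqP; split => w /=.
  by move=> H i j; rewrite inE; apply: (H (i, j)) => /=; rewrite mem_index_enum.
by move=> H [i j] _ /=; have := H i j; rewrite inE.
Qed.

(** This is the Laplace transform of a rescaled chi-squared variable with [t] degrees of freedom. *)
Lemma gaussian_mgf v (lam : R) : 0 < 1 + 2 * lam * enorm v ^+ 2 / t%:R ->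
  (\int[Pr]_w (expR (- lam * enorm (Gmat G w *m v) ^+ 2))%:E =
   ((Num.sqrt (1 + 2 * lam * enorm v ^+ 2 / t%:R))^-1 ^+ t)%:E)%E.
Proof.
have [mG lawG _] := iidG.
move=> k0.
have row_sum (F : 'I_t * 'I_d -> R) (i : 'I_t) :
    \sum_(p <- index_enum _ | p.1 == i) F p = \sum_j F (i, j).
  transitivity (\sum_(i' | i' == i) \sum_j F (i', j)).
    rewrite pair_big_dep/=; apply: eq_big => [[i' j']|[i' j'] _]//=.
    by rewrite andbT.
  by rewrite big_pred1_eq.
have sigma2 : Num.sqrt (t%:R^-1) ^+ 2 = t%:R^-1 :> R.
  by rewrite sqr_sqrtr// invr_ge0.
have rowsqrE i : rowsqr t (fun p : 'I_t * 'I_d => p.1) (fun p => v p.2 ord0)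
    (index_enum _) i = enorm v ^+ 2.
  by rewrite /rowsqr row_sum enorm_sqr.
have kE i : 1 + 2 * lam * Num.sqrt (t%:R^-1) ^+ 2 *
    rowsqr t (fun p : 'I_t * 'I_d => p.1) (fun p => v p.2 ord0)
    (index_enum _) i = 1 + 2 * lam * enorm v ^+ 2 / t%:R.
  by rewrite rowsqrE sigma2 mulrAC.
have := @gaussian_rows_mgf R _ _ Pr _ (fun p : 'I_t * 'I_d => G p.1 p.2)
  (fun p => mG p.1 p.2) t (fun p => p.1) (fun p => v p.2 ord0) (Num.sqrt (t%:R^-1)).
move=> /(_ _ _ (index_enum _) (fun=> lam)) H.
transitivity (\int[Pr]_w (expR (\sum_(i < t) - lam * rowsum t
   (fun p : 'I_t * 'I_d => p.1) (fun p => v p.2 ord0)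
   (fun p => G p.1 p.2 w) (index_enum _) i ^+ 2))%:E)%E.
  apply: eq_integral => w _; congr (expR _)%:E.
  rewrite enorm_sqr mulr_sumr; apply: eq_bigr => i _; congr (_ * _ ^+ 2).
  rewrite /rowsum row_sum mxE; apply: eq_bigr => j _.
  by rewrite mxE mulrC.
rewrite H.
- by under eq_bigr do rewrite kE; rewrite prodr_const card_ord.
- by rewrite sqrtr_eq0 -ltNge invr_gt0 ltr0n.
- by move=> p B mB; exact: lawG.
- exact: index_enum_uniq.
- exact: iid_joint_product.
- by move=> i; rewrite kE.
Qed.

Lemma chernoff (A : set Omega) (f : Omega -> R) : measurable A ->
  measurable_fun setT f -> (forall w, A w -> 0 <= f w) ->
  (Pr A <= \int[Pr]_w (expR (f w))%:E)%E.
Proof.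
move=> mA mf Af.
have me : measurable_fun setT (fun w => (expR (f w))%:E).
  by apply/measurable_EFinP; exact: measurableT_comp.
apply: (@le_trans _ _ (\int[Pr]_(w in A) (expR (f w))%:E)%E); last first.
  by apply: ge0_subset_integral => //= w _; rewrite lee_fin expR_ge0.
have -> : Pr A = (\int[Pr]_(x in A) cst 1 x)%E by rewrite integral_cst// mul1e.
apply: ge0_le_integral => //=.
- exact: measurable_funTS.
- by move=> w Aw; rewrite lee_fin -[leLHS]expR0 ler_expR; exact: Af.
Qed.

(** One exponential Markov bound serves three events: the upper tail with [lam < 0], the lower tail
    with [lam > 0], and the kernel with [c = 0] and [lam] large. *)
Lemma gaussian_tail v (A : set Omega) (lam c : R) : measurable A ->
  0 < 1 + 2 * lam * enorm v ^+ 2 / t%:R ->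
  (forall w, A w -> 0 <= - lam * enorm (Gmat G w *m v) ^+ 2 + c) ->
  (Pr A <= ((Num.sqrt (1 + 2 * lam * enorm v ^+ 2 / t%:R))^-1 ^+ t * expR c)%:E)%E.
Proof.
move=> mA k0 Af.
have mf : measurable_fun setT (fun w => - lam * enorm (Gmat G w *m v) ^+ 2).
  by apply: measurable_funM => //; apply: measurable_funX; exact: measurable_enorm_Gmat.
apply: (le_trans (chernoff A _ mA _ Af)); first exact: measurable_funD.
under eq_integral do rewrite expRD EFinM muleC.
rewrite ge0_integralZl//; last first.
  by apply/measurable_EFinP; exact: measurableT_comp.
by rewrite gaussian_mgf// -EFinM mulrC.
Qed.

Lemma measurable_enorm_gt v (c : R) :
  measurable [set w | c < enorm (Gmat G w *m v)].
Proof.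
have := measurable_enorm_Gmat v measurableT `]c, +oo[%classic (measurable_itv _).
rewrite setTI; congr (measurable _).
by apply/seteqP; split => w /=; rewrite in_itv/= andbT.
Qed.

Lemma measurable_enorm_lt v (c : R) :
  measurable [set w | enorm (Gmat G w *m v) < c].
Proof.
have := measurable_enorm_Gmat v measurableT `]-oo, c[%classic (measurable_itv _).
by rewrite setTI.
Qed.

Lemma measurable_Gmat_ker v : measurable [set w | Gmat G w *m v = 0].
Proof.
rewrite (_ : [set _ | _] = ~` [set w | 0 < enorm (Gmat G w *m v)]).
  by apply: measurableC; exact: measurable_enorm_gt.
apply/seteqP; split => w /=; first by move=> ->; rewrite enorm0 ltxx.
by move=> /negP; rewrite -leNgt => h; apply/eqP; rewrite -enorm_eq0 eq_le h enorm_ge0.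
Qed.

(* [lam < 0] is chosen so that the variance factor is [1 / (1 + e)]; then
   [sqrt (1 + e) <= expR (e / 2)] makes the exponent exactly [- t e^2 / 2]. *)
Lemma gaussian_upper_tail v (e : R) : 0 < e ->
  (Pr [set w | ((1 + e) * enorm v < enorm (Gmat G w *m v))%R] <=
   (expR (- (t%:R * e ^+ 2 / 2)))%:E)%E.
Proof.
move=> e0; have tR0 : 0 < t%:R :> R by rewrite ltr0n.
have [->|v0] := eqVneq v 0.
  rewrite (_ : [set _ | _] = set0) ?measure0 ?lee_fin ?expR_ge0//.
  by rewrite -subset0 => w /=; rewrite mulmx0 !enorm0 mulr0 ltxx.
have {}v0 : 0 < enorm v by rewrite lt_neqAle enorm_ge0 eq_sym enorm_eq0 v0.
have vn0 : enorm v != 0 by rewrite gt_eqF.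
have e1 : 1 + e != 0 by rewrite gt_eqF// addr_gt0.
pose lam := - (e / (1 + e) * t%:R / (2 * enorm v ^+ 2)).
have kE : 1 + 2 * lam * enorm v ^+ 2 / t%:R = (1 + e)^-1.
  by rewrite /lam; field; rewrite e1 vn0 gt_eqF.
apply: (le_trans (gaussian_tail v _ lam (lam * ((1 + e) * enorm v) ^+ 2) _ _ _)).
- exact: measurable_enorm_gt.
- by rewrite kE invr_gt0 addr_gt0.
- move=> w /= Aw; rewrite /lam opprK mulNr -mulrBr.
  have e10 : 0 <= 1 + e by rewrite addr_ge0 ?(ltW e0).
  apply: mulr_ge0.
    by rewrite !(mulr_ge0, invr_ge0) ?enorm_ge0 ?(ltW tR0) ?(ltW e0).
  by rewrite subr_ge0 lerXn2r ?nnegrE ?enorm_ge0 ?(ltW Aw)// mulr_ge0 ?enorm_ge0.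
rewrite kE lee_fin sqrtrV ?invrK ?addr_ge0 ?(ltW e0)//.
have se : Num.sqrt (1 + e) <= expR (e / 2).
  rewrite -(ler_pXn2r (ltn0Sn 1)) ?nnegrE ?sqrtr_ge0 ?expR_ge0//.
  rewrite sqr_sqrtr ?addr_ge0 ?(ltW e0)// -expRM_natl mulrC.
  by rewrite mulfVK ?expR_ge1Dx.
apply: (@le_trans _ _ (expR (e / 2) ^+ t * expR (lam * ((1 + e) * enorm v) ^+ 2))).
  by rewrite ler_wpM2r ?expR_ge0// lerXn2r ?nnegrE ?sqrtr_ge0 ?expR_ge0.
rewrite -expRM_natl -expRD ler_expR le_eqVlt; apply/orP; left; apply/eqP.
by rewrite /lam; field; rewrite vn0 e1.
Qed.

(* As for the upper tail, with [lam > 0] such that the variance factor is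
   [1 / (1 - e)]. *)
Lemma gaussian_lower_tail v (e : R) : 0 < e -> e < 1 ->
  (Pr [set w | (enorm (Gmat G w *m v) < (1 - e) * enorm v)%R] <=
   (expR (- (t%:R * e ^+ 2 / 2)))%:E)%E.
Proof.
move=> e0 e1; have tR0 : 0 < t%:R :> R by rewrite ltr0n.
have [->|v0] := eqVneq v 0.
  rewrite (_ : [set _ | _] = set0) ?measure0 ?lee_fin ?expR_ge0//.
  by rewrite -subset0 => w /=; rewrite mulmx0 !enorm0 mulr0 ltxx.
have {}v0 : 0 < enorm v by rewrite lt_neqAle enorm_ge0 eq_sym enorm_eq0 v0.
have vn0 : enorm v != 0 by rewrite gt_eqF.
have e1' : 0 < 1 - e by rewrite subr_gt0.
have e1n : 1 - e != 0 by rewrite gt_eqF.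
pose lam := e / (1 - e) * t%:R / (2 * enorm v ^+ 2).
have lam0 : 0 <= lam.
  by rewrite !(mulr_ge0, invr_ge0) ?enorm_ge0 ?(ltW tR0) ?(ltW e0) ?(ltW e1').
have kE : 1 + 2 * lam * enorm v ^+ 2 / t%:R = (1 - e)^-1.
  by rewrite /lam; field; rewrite e1n vn0 gt_eqF.
apply: (le_trans (gaussian_tail v _ lam (lam * ((1 - e) * enorm v) ^+ 2) _ _ _)).
- exact: measurable_enorm_lt.
- by rewrite kE invr_gt0.
- move=> w /= Aw; rewrite addrC (mulNr lam) -mulrBr mulr_ge0//.
  rewrite subr_ge0 lerXn2r ?nnegrE ?enorm_ge0 ?(ltW Aw)//.
  by rewrite mulr_ge0 ?enorm_ge0// ltW.
rewrite kE lee_fin sqrtrV ?invrK ?(ltW e1')//.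
have se : Num.sqrt (1 - e) <= expR (- e / 2).
  rewrite -(ler_pXn2r (ltn0Sn 1)) ?nnegrE ?sqrtr_ge0 ?expR_ge0//.
  rewrite sqr_sqrtr ?(ltW e1')// -expRM_natl mulrC.
  by rewrite mulfVK ?expR_ge1Dx.
apply: (@le_trans _ _ (expR (- e / 2) ^+ t * expR (lam * ((1 - e) * enorm v) ^+ 2))).
  by rewrite ler_wpM2r ?expR_ge0// lerXn2r ?nnegrE ?sqrtr_ge0 ?expR_ge0.
rewrite -expRM_natl -expRD ler_expR le_eqVlt; apply/orP; left; apply/eqP.
by rewrite /lam; field; rewrite vn0 e1n.
Qed.

(** On this event the exponent vanishes for every [lam], so [lam] may be as large as desired. The
    choice makes the factor of a single row (1 + delta^-2)^(-1/2) <= delta, and there is at least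
    one row. *)
Lemma gaussian_ker v (delta : R) : v != 0 -> 0 < delta ->
  (Pr [set w | Gmat G w *m v = 0%R] <= delta%:E)%E.
Proof.
move=> v0 d0'; have tR0 : 0 < t%:R :> R by rewrite ltr0n.
have {}v0 : 0 < enorm v by rewrite lt_neqAle enorm_ge0 eq_sym enorm_eq0 v0.
have vn0 : enorm v != 0 by rewrite gt_eqF.
pose lam := t%:R / (2 * enorm v ^+ 2 * delta ^+ 2).
have kE : 1 + 2 * lam * enorm v ^+ 2 / t%:R = 1 + (delta ^+ 2)^-1.
  by rewrite /lam; field; rewrite vn0 !gt_eqF.
have k1 : 1 <= 1 + (delta ^+ 2)^-1 by rewrite lerDl invr_ge0 sqr_ge0.
have k0 : 0 < 1 + (delta ^+ 2)^-1 by rewrite (lt_le_trans _ k1).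
apply: (le_trans (gaussian_tail v _ lam 0 _ _ _)).
- exact: measurable_Gmat_ker.
- by rewrite kE.
- by move=> w /= ->; rewrite enorm0 expr0n mulr0 addr0.
rewrite kE lee_fin expR0 mulr1.
have sk1 : 1 <= Num.sqrt (1 + (delta ^+ 2)^-1) by rewrite -[leLHS]sqrtr1 ler_sqrt ?(ltW k0) ?k1.
have sk0 : 0 < Num.sqrt (1 + (delta ^+ 2)^-1) := lt_le_trans ltr01 sk1.
apply: (@le_trans _ _ (Num.sqrt (1 + (delta ^+ 2)^-1))^-1).
  rewrite ler_iXnr ?invr_ge0 ?(ltW sk0)// invf_le1//.
rewrite -[leRHS]invrK lef_pV2 ?posrE ?invr_gt0//.
rewrite -[leLHS]ger0_norm ?invr_ge0 ?(ltW d0')// -sqrtr_sqr ler_sqrt ?(ltW k0)//.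
by rewrite exprVn lerDr.
Qed.

End gaussian_matrix.

(** * Kirszbraun's theorem for balls of equal radii *)

Section variance.
Context {R : realType} {n m : nat}.
Implicit Types (w : 'I_n -> R) (v : 'I_n -> 'cV[R]_m) (x : 'cV[R]_m).

Lemma sum_weighted_sqr w (a : 'I_n -> R) (x : R) : \sum_j w j = 1 ->
  \sum_j w j * (x - a j) ^+ 2 =
  (x - \sum_j w j * a j) ^+ 2 + \sum_j w j * ((\sum_j w j * a j) - a j) ^+ 2.
Proof.
move=> w1; set b := \sum_j w j * a j.
have E y : \sum_j w j * (y - a j) ^+ 2 = y ^+ 2 - 2 * y * b + \sum_j w j * a j ^+ 2.
  transitivity (\sum_j (y ^+ 2 * w j - 2 * y * (w j * a j) + w j * a j ^+ 2)).
    by apply: eq_bigr => j _; ring.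
  by rewrite big_split sumrB -!mulr_sumr w1 mulr1.
by rewrite !E; ring.
Qed.

Definition wmean w v : 'cV[R]_m := \sum_j w j *: v j.
Definition wvar w v : R := \sum_j w j * edist (wmean w v) (v j) ^+ 2.

Lemma edist_sqr x y : edist x y ^+ 2 = \sum_k (x k ord0 - y k ord0) ^+ 2.
Proof. by rewrite enorm_sqr; apply: eq_bigr => k _; rewrite !mxE. Qed.

(** The parallel axis identity of Huygens and Steiner, coordinate by coordinate. *)
Lemma sum_weighted_edist w v x : \sum_j w j = 1 ->
  \sum_j w j * edist x (v j) ^+ 2 = edist x (wmean w v) ^+ 2 + wvar w v.
Proof.
move=> w1; rewrite /wvar.
have mE k : wmean w v k ord0 = \sum_j w j * v j k ord0.
  by rewrite /wmean summxE; apply: eq_bigr => j _; rewrite mxE.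
have E y : \sum_j w j * edist y (v j) ^+ 2 =
    \sum_k \sum_j w j * (y k ord0 - v j k ord0) ^+ 2.
  rewrite exchange_big; apply: eq_bigr => j _.
  by rewrite edist_sqr mulr_sumr.
rewrite !E edist_sqr -big_split; apply: eq_bigr => k _.
by rewrite sum_weighted_sqr//= mE.
Qed.

End variance.

Lemma edistC {R : realType} {m} (x y : 'cV[R]_m) : edist x y = edist y x.
Proof.
rewrite /edist /enorm; congr Num.sqrt; apply: eq_bigr => k _.
by rewrite !mxE -opprB sqrrN.
Qed.

Lemma edistxx {R : realType} {m} (x : 'cV[R]_m) : edist x x = 0.
Proof. by rewrite /edist subrr enorm0. Qed.

(** The variance depends on pairwise distances only, which is how a Lipschitz bound controls it. *)
Lemma sum_pairs_edist {R : realType} {n m} (w : 'I_n -> R) (v : 'I_n -> 'cV[R]_m) :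
  \sum_j w j = 1 ->
  \sum_i w i * (\sum_j w j * edist (v i) (v j) ^+ 2) = 2 * wvar w v.
Proof.
move=> w1; under eq_bigr do rewrite sum_weighted_edist// mulrDr edistC.
rewrite big_split /= -mulr_suml w1 mul1r -/(wvar w v).
by rewrite /wvar; ring.
Qed.

(* Moving weight [s] towards the point [v i] changes the variance by
   [s (|v i - mean|^2 - variance) - s^2 |v i - mean|^2], so at a near-maximiser of
   the variance no point is much farther than the standard deviation from the mean. *)
Lemma wvar_shift {R : realType} {n m} (w : 'I_n -> R) (v : 'I_n -> 'cV[R]_m)
    (i : 'I_n) (s : R) : \sum_j w j = 1 ->
  let w' j := (1 - s) * w j + s * (j == i)%:R in
  \sum_j w' j = 1 /\
  wvar w' v = (1 - s) * wvar w v + s * (1 - s) * edist (wmean w v) (v i) ^+ 2.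
Proof.
move=> w1 w'.
have sum_w' (F : 'I_n -> R) : \sum_j w' j * F j = (1 - s) * (\sum_j w j * F j) + s * F i.
  transitivity (\sum_j ((1 - s) * (w j * F j) + s * ((j == i)%:R * F j))).
    by apply: eq_bigr => j _; rewrite /w'; ring.
  rewrite big_split /= -!mulr_sumr; congr (_ + s * _).
  rewrite (bigD1 i)//= eqxx mul1r big1 ?addr0// => j /negbTE ->.
  by rewrite mul0r.
have w'1 : \sum_j w' j = 1.
  have := sum_w' (fun=> 1); under eq_bigr do rewrite mulr1; move=> ->.
  by under eq_bigr do rewrite mulr1; rewrite w1; ring.
split=> //.
have := sum_weighted_edist w' v (wmean w v) w'1.
rewrite sum_w' -/(wvar w v).
have -> : edist (wmean w v) (wmean w' v) ^+ 2 = s ^+ 2 * edist (wmean w v) (v i) ^+ 2.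
  rewrite !edist_sqr mulr_sumr; apply: eq_bigr => k _.
  have -> : wmean w' v k ord0 = (1 - s) * wmean w v k ord0 + s * v i k ord0.
    rewrite /wmean !summxE.
    transitivity (\sum_j w' j * v j k ord0); first by apply: eq_bigr => j _; rewrite mxE.
    by rewrite sum_w'; congr (_ * _ + _); apply: eq_bigr => j _; rewrite mxE.
  by ring.
by move=> H; apply: (addrI (s ^+ 2 * edist (wmean w v) (v i) ^+ 2)); rewrite -H; ring.
Qed.

(** The [u i] have variance at most [rho ^+ 2], their mean squared distance to [c] being at most
    that; hence the [v i] have variance at most [(L * rho) ^+ 2] under every weighting. The mean of
    a nearly variance-maximising weighting is the center sought, by [wvar_shift]. The strict
    inequality [L * rho < r] pays for near-maximality. *)
Lemma kirszbraun_ball {R : realType} {n m m'} (u : 'I_n -> 'cV[R]_m)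
    (v : 'I_n -> 'cV[R]_m') (c : 'cV[R]_m) (L rho r : R) :
  0 <= L -> 0 <= rho -> L * rho < r ->
  (forall i j, edist (v i) (v j) <= L * edist (u i) (u j)) ->
  (forall i, edist (u i) c <= rho) ->
  exists y, forall i, edist (v i) y <= r.
Proof.
move=> L0 rho0 Lr lip uc.
case: n u v lip uc => [|n] u v lip uc; first by exists 0 => -[].
pose M := (L * rho) ^+ 2; pose eta := r ^+ 2 - M.
have M0 : 0 <= M by exact: sqr_ge0.
have r0 : 0 <= r by apply: ltW; apply: le_lt_trans Lr; exact: mulr_ge0.
have eta0 : 0 < eta by rewrite subr_gt0 ltrXn2r ?mulr_ge0.
pose simplex (w : 'I_n.+1 -> R) := (forall j, 0 <= w j) /\ \sum_j w j = 1.
have varM w : simplex w -> wvar w v <= M.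
  move=> [w0 w1]; rewrite -(ler_pM2l (ltr0n _ 2)) -sum_pairs_edist//.
  apply: (@le_trans _ _ (L ^+ 2 * (2 * wvar w u))).
    rewrite -sum_pairs_edist// mulr_sumr ler_sum// => i _.
    rewrite [leRHS]mulrCA ler_wpM2l// mulr_sumr ler_sum// => j _.
    rewrite [leRHS]mulrCA ler_wpM2l// -exprMn lerXn2r ?nnegrE ?mulr_ge0 ?enorm_ge0//.
  rewrite [leLHS]mulrCA ler_wpM2l// /M exprMn ler_wpM2l ?sqr_ge0//.
  have := sum_weighted_edist w u c w1.
  have le1 : \sum_j w j * edist c (u j) ^+ 2 <= rho ^+ 2.
    rewrite -[leRHS]mul1r -w1 mulr_suml ler_sum// => j _.
    by rewrite ler_wpM2l// lerXn2r ?nnegrE ?enorm_ge0// edistC.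
  by have := sqr_ge0 (edist c (wmean w u)); lra.
(* Solves M + s = (1 - s) (M + eta), where M + eta = r^2. A weighting within s^2 of the supremum
   gains at most s^2 when weight [s] is shifted; dividing by [s] leaves (1 - s) q <= M + s. *)
pose s := eta / (1 + M + eta).
have D0 : 0 < 1 + M + eta by lra.
have s0 : 0 < s by rewrite divr_gt0.
have s1 : s < 1 by rewrite ltr_pdivrMr//; lra.
have sD : s * (1 + M + eta) = eta by rewrite /s; field; rewrite gt_eqF.
pose S := [set x : R | exists2 w, simplex w & x = wvar w v].
have supS : has_sup S.
  split; last by exists M => _ [w sw ->]; exact: varM.
  exists (wvar (fun j => (j == ord0)%:R) v), (fun j => (j == ord0)%:R) => //; split.
    by move=> j; rewrite ler0n.
  by rewrite (bigD1 ord0)//= big1 ?addr0// => j /negbTE ->.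
have [_ [w [w0 w1] ->] wsup] := sup_adherent (exprn_gt0 2 s0) supS.
exists (wmean w v) => i; rewrite edistC.
rewrite -(ler_pXn2r (ltn0Sn 1)) ?nnegrE ?enorm_ge0//.
have [w'1 w'E] := wvar_shift w v i s w1.
have le_sup : (1 - s) * wvar w v + s * (1 - s) * edist (wmean w v) (v i) ^+ 2 <= sup S.
  rewrite -w'E; apply: sup_upper_bound => //; eexists; last reflexivity.
  split=> [j|]; last exact: w'1.
  apply: addr_ge0; apply: mulr_ge0 => //.
    by rewrite subr_ge0 ltW.
  exact: ltW.
have wM : wvar w v <= M by exact: varM.
move: le_sup; set q := edist _ _ ^+ 2 => le_sup.
have : s * ((1 - s) * q) <= s * (wvar w v + s) by rewrite expr2 in wsup; lra.
rewrite ler_pM2l// => le_q.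
have : (1 - s) * q <= (1 - s) * r ^+ 2.
  have -> : r ^+ 2 = M + eta by rewrite /eta; ring.
  by lra.
by rewrite ler_pM2l// subr_gt0.
Qed.

(** * The k-center cost with outliers *)

Section metric.
Context {R : realType} {m : nat}.
Implicit Types x y z : 'cV[R]_m.

Lemma enormD x y : enorm (x + y) <= enorm x + enorm y.
Proof.
rewrite -(ler_pXn2r (ltn0Sn 1)) ?nnegrE ?addr_ge0 ?enorm_ge0//.
pose D := \sum_(i < m) x i ord0 * y i ord0.
have -> : enorm (x + y) ^+ 2 = enorm x ^+ 2 + 2 * D + enorm y ^+ 2.
  rewrite !enorm_sqr mulr_sumr -!big_split; apply: eq_bigr => i _ /=.
  by rewrite mxE; ring.
suff : D <= enorm x * enorm y by lra.
have [x0|xn0] := eqVneq x 0.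
  by rewrite /D big1 ?mulr_ge0 ?enorm_ge0// => i _; rewrite x0 mxE mul0r.
have [y0|yn0] := eqVneq y 0.
  by rewrite /D big1 ?mulr_ge0 ?enorm_ge0// => i _; rewrite y0 mxE mulr0.
have xy0 : 0 < enorm x * enorm y.
  by rewrite mulr_gt0// lt_neqAle enorm_ge0 eq_sym enorm_eq0 ?xn0 ?yn0.
have : 0 <= \sum_(i < m) (enorm y * x i ord0 - enorm x * y i ord0) ^+ 2.
  by apply: sumr_ge0 => i _; exact: sqr_ge0.
have -> : \sum_(i < m) (enorm y * x i ord0 - enorm x * y i ord0) ^+ 2 =
    2 * (enorm x * enorm y) * (enorm x * enorm y - D).
  transitivity (enorm y ^+ 2 * (\sum_(i < m) x i ord0 ^+ 2) -
    2 * (enorm x * enorm y) * D + enorm x ^+ 2 * (\sum_(i < m) y i ord0 ^+ 2)).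
    by rewrite !mulr_sumr -sumrB -big_split; apply: eq_bigr => i _ /=; ring.
  by rewrite -!enorm_sqr; ring.
have xy2 : 0 < 2 * (enorm x * enorm y) by apply: mulr_gt0.
by rewrite (pmulr_rge0 _ xy2) subr_ge0.
Qed.

Lemma edist_ge0 x y : 0 <= edist x y. Proof. exact: enorm_ge0. Qed.

Lemma edist_eq0 x y : (edist x y == 0) = (x == y).
Proof. by rewrite enorm_eq0 subr_eq0. Qed.

Lemma edist_triangle y x z : edist x z <= edist x y + edist y z.
Proof. by rewrite /edist -[x - z](subrKA y) enormD. Qed.

(** Ends the chaining after finitely many halvings, and turns optimum zero into a statement about
    the number of points. *)
Lemma exists_separation (P : seq 'cV[R]_m) :
  exists2 delta, 0 < delta & {in P &, forall x y, edist x y < delta -> x = y}.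
Proof.
pose D := [seq r <- [seq edist x y | x <- P, y <- P] | 0 < r].
have [delta d0 dD] : exists2 delta : R, 0 < delta & {in D, forall r, delta <= r}.
  have : {in D, forall r, 0 < r} by move=> r; rewrite mem_filter => /andP[].
  elim: D => [|r D IH] D0; first by exists 1.
  have [q Dq|delta d0 dD] := IH; first by apply: D0; rewrite inE Dq orbT.
  exists (Num.min r delta) => [|q]; first by rewrite lt_min d0 D0 ?inE ?eqxx.
  by rewrite inE ge_min => /predU1P[->|/dD ->]; rewrite ?lexx ?orbT.
exists delta => // x y xP yP xy; apply/eqP; apply: contraTT xy => xy.
rewrite -leNgt; apply: dD; rewrite mem_filter lt_neqAle eq_sym edist_eq0 xy edist_ge0.
by apply/allpairsP; exists (x, y).
Qed.

End metric.

Section kcenter.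
Context {R : realType} {m : nat}.
Implicit Types (x c : 'cV[R]_m) (X C Z P : seq 'cV[R]_m) (k z : nat).

Lemma mindist_le x c C : c \in C -> mindist x C <= edist x c.
Proof.
case: C => // c0 C; elim: C => [|c1 C IH] /=; first by rewrite inE => /eqP ->.
rewrite !inE => /or3P[cc|/eqP ->|cC]; rewrite ge_min ?lexx//.
  by rewrite IH ?orbT// inE cc.
by rewrite IH ?orbT// inE cC orbT.
Qed.

Lemma mindist_mem x C : C != [::] -> exists2 c, c \in C & mindist x C = edist x c.
Proof.
case: C => // c0 C _; elim: C => [|c1 C [c cC /= cE]] /=.
  by exists c0; rewrite ?inE.
rewrite /Num.min; case: ifP => _; first by exists c1; rewrite ?inE ?eqxx ?orbT.
by exists c => //; move: cC; rewrite !inE => /orP[|] ->; rewrite ?orbT.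
Qed.

Lemma kc_cost_ge0 X C Z : 0 <= kc_cost X C Z.
Proof.
rewrite /kc_cost; elim: X => [|x X IH]; first by rewrite big_nil.
by rewrite big_cons; case: ifP => // _; rewrite le_max IH orbT.
Qed.

Lemma mindist_kc_cost x X C Z : x \in X -> x \notin Z -> mindist x C <= kc_cost X C Z.
Proof.
rewrite /kc_cost => + xZ; elim: X => // y X IH; rewrite inE big_cons.
move=> /predU1P[<-|/IH]; [rewrite xZ|case: ifP => //]; rewrite le_max ?lexx//.
by move=> _ ->; rewrite orbT.
Qed.

Lemma kc_cost_le X C Z r : 0 <= r ->
  (forall x, x \in X -> x \notin Z -> mindist x C <= r) -> kc_cost X C Z <= r.
Proof.
move=> r0 H; rewrite /kc_cost big_seq_cond; elim/big_ind : _ => //.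
  by move=> a b ar br; rewrite ge_max ar.
by move=> x /andP[]; exact: H.
Qed.

Lemma kc_cost_cover X C Z x : C != [::] -> x \in X -> x \notin Z ->
  exists2 c, c \in C & edist x c <= kc_cost X C Z.
Proof.
move=> C0 xX xZ; have [c cC E] := mindist_mem x C C0.
by exists c => //; rewrite -E; exact: mindist_kc_cost.
Qed.

Lemma opt_outliers_le X C Z k z : uniq C -> size C = k -> uniq Z ->
  {subset Z <= X} -> (size Z <= z)%N -> opt_outliers X k z <= kc_cost X C Z.
Proof.
move=> uC sC uZ ZX sZ; apply: ge_inf; last by exists C, Z.
by exists 0 => _ [C' [Z' [_ _ _ _ ->]]]; exact: kc_cost_ge0.
Qed.

(** The optimum asks for exactly [k] distinct centers, whereas constructions produce lists with
    possible repetitions. Points of [X] fill the gap; [C] comes first in [D] so that truncation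
    keeps it. *)
Lemma pad_centers C X k : (size C <= k)%N -> (k <= size (undup X))%N ->
  exists C', [/\ uniq C', size C' = k & {subset C <= C'}].
Proof.
move=> Ck kX; pose D := undup C ++ [seq x <- undup X | x \notin C].
have uD : uniq D.
  rewrite cat_uniq undup_uniq filter_uniq ?undup_uniq// andbT.
  by apply/hasPn => x; rewrite mem_filter => /andP[xC _] /=; rewrite mem_undup.
have sD : (k <= size D)%N.
  apply: (leq_trans kX); apply: uniq_leq_size; first exact: undup_uniq.
  by move=> x xX; rewrite mem_cat mem_undup mem_filter xX andbT orbN.
exists (take k D); split; first exact: take_uniq.
  by rewrite size_takel.
move=> c cC; rewrite take_cat ltnNge (leq_trans (size_undup _) Ck)/=.
by rewrite mem_cat mem_undup cC.
Qed.

Lemma opt_outliers_cover X C Z k z r : (0 < k)%N -> (size C <= k)%N ->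
  (k <= size (undup X))%N -> uniq Z -> {subset Z <= X} -> (size Z <= z)%N ->
  0 <= r ->
  (forall x, x \in X -> x \notin Z -> exists2 c, c \in C & edist x c <= r) ->
  opt_outliers X k z <= r.
Proof.
move=> k0 Ck kX uZ ZX sZ r0 cov.
have [C' [uC' sC' CC']] := pad_centers C X k Ck kX.
apply: (@le_trans _ _ (kc_cost X C' Z)); first exact: opt_outliers_le.
apply: kc_cost_le => // x xX xZ; have [c cC xc] := cov x xX xZ.
by apply: le_trans xc; apply: mindist_le; exact: CC'.
Qed.

Lemma opt_outliers_approx X k z (eta : R) : (k <= size (undup X))%N -> 0 < eta ->
  exists C Z, [/\ size C = k, uniq Z, {subset Z <= X}, (size Z <= z)%N &
    kc_cost X C Z < opt_outliers X k z + eta].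
Proof.
move=> kX eta0.
have [C [uC sC _]] := pad_centers [::] X k (leq0n k) kX.
rewrite /opt_outliers; set S := (X in inf X + _); have : has_inf S.
  split; first by exists (kc_cost X C [::]), C, [::].
  by exists 0 => _ [C' [Z' [_ _ _ _ ->]]]; exact: kc_cost_ge0.
move=> /(inf_adherent eta0)[_ [C' [Z' [[_ sC'] uZ' ZX' sZ' ->]]] lt].
by exists C', Z'.
Qed.

Lemma le_opt_outliers X k z (b : R) : (k <= size (undup X))%N ->
  (forall C Z, size C = k -> uniq Z -> {subset Z <= X} -> (size Z <= z)%N ->
    b <= kc_cost X C Z) -> b <= opt_outliers X k z.
Proof.
move=> kX H; have [C [uC sC _]] := pad_centers [::] X k (leq0n k) kX.
apply: lb_le_inf; first by exists (kc_cost X C [::]), C, [::].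
by move=> _ [C' [Z' [[_ sC'] uZ' ZX' sZ' ->]]]; exact: H.
Qed.

Lemma opt_outliers_ge0 X k z : (k <= size (undup X))%N -> 0 <= opt_outliers X k z.
Proof. by move=> kX; apply: le_opt_outliers => // *; exact: kc_cost_ge0. Qed.

(** A solution of cost below half the separation of [P] cannot serve two distinct points by one
    center, so sending a point to its center is injective. *)
Lemma opt_outliers_eq0 P k z : uniq P -> (0 < k)%N -> (k <= size P)%N ->
  opt_outliers P k z = 0 ->
  exists Z, [/\ uniq Z, {subset Z <= P}, (size Z <= z)%N &
    (size [seq x <- P | x \notin Z] <= k)%N].
Proof.
move=> uP k0 kP opt0.
have [delta d0 sepP] := exists_separation P.
have d20 : 0 < delta / 2 by rewrite divr_gt0.
have kP' : (k <= size (undup P))%N by rewrite undup_id.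
have [C [Z [sC uZ ZP sZ]]] := opt_outliers_approx P k z (delta / 2) kP' d20.
rewrite opt0 add0r => cost_lt.
exists Z; split=> //.
pose near x c := edist x c < delta / 2.
pose f x := nth 0 C (find (near x) C).
have hasC x : x \in P -> x \notin Z -> has (near x) C.
  move=> xP xZ; have C0 : C != [::] by rewrite -size_eq0 sC -lt0n.
  have [c cC xc] := kc_cost_cover P C Z x C0 xP xZ.
  by apply/hasP; exists c => //; exact: le_lt_trans cost_lt.
rewrite -sC -(size_map f [seq x <- P | x \notin Z]); apply: uniq_leq_size.
  rewrite map_inj_in_uniq ?filter_uniq// => x y.
  rewrite !mem_filter => /andP[xZ xP] /andP[yZ yP] fxy.
  apply: sepP => //; rewrite (splitr delta).
  apply: (le_lt_trans (edist_triangle (f x) x y)); apply: ltrD.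
    exact: nth_find (hasC x xP xZ).
  by rewrite edistC fxy; exact: nth_find (hasC y yP yZ).
move=> _ /mapP[x + ->]; rewrite mem_filter => /andP[xZ xP].
by rewrite mem_nth// -has_find hasC.
Qed.

End kcenter.

(** * Transfer between P and its image *)

Section transfer.
Context {R : realType} {t d : nat} (A : 'M[R]_(t, d)) (P : seq 'cV[R]_d) (k z : nat).
Hypotheses (uP : uniq P) (k0 : (0 < k)%N) (kP : (k <= size P)%N).
Hypothesis injA : {in P &, injective (mulmx A : 'cV[R]_d -> 'cV[R]_t)}.

Local Notation GP := (img A P).

(** Outliers are removed by membership, so without injectivity an image outlier could remove other
    points as well. *)
Lemma mem_img (S : seq 'cV[R]_d) x : {subset S <= P} -> x \in P ->
  (A *m x \in img A S) = (x \in S).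
Proof.
move=> SP xP; apply/mapP/idP => [[y yS /injA ->//]|xS]; last by exists x.
exact: SP.
Qed.

Lemma uniq_img (S : seq 'cV[R]_d) : uniq S -> {subset S <= P} -> uniq (img A S).
Proof.
move=> uS SP; rewrite map_inj_in_uniq// => x y xS yS.
by apply: injA; exact: SP.
Qed.

Lemma img_sub (S : seq 'cV[R]_d) : {subset S <= P} -> {subset img A S <= GP}.
Proof. by move=> SP _ /mapP[x xS ->]; apply: map_f; exact: SP. Qed.

Lemma size_undup_img : (k <= size (undup GP))%N.
Proof. by rewrite undup_id ?size_map// uniq_img. Qed.

Lemma size_undup_points : (k <= size (undup P))%N.
Proof. by rewrite undup_id. Qed.

Lemma edist_img x y : edist (A *m x) (A *m y) = enorm (A *m (x - y)).
Proof. by rewrite /edist mulmxBr. Qed.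

Lemma opt_outliers_img_eq0 : opt_outliers P k z = 0 -> opt_outliers GP k z = 0.
Proof.
move=> /(opt_outliers_eq0 _ _ _ uP k0 kP)[Z [uZ ZP sZ sPZ]].
apply/eqP; rewrite eq_le (opt_outliers_ge0 _ _ _ size_undup_img) andbT.
apply: (opt_outliers_cover _ (img A [seq x <- P | x \notin Z]) (img A Z)) => //.
- by rewrite size_map.
- exact: size_undup_img.
- exact: uniq_img.
- exact: img_sub.
- by rewrite size_map.
- move=> _ /mapP[x xP ->]; rewrite mem_img// => xZ.
  exists (A *m x); last by rewrite edistxx.
  by apply: map_f; rewrite mem_filter xZ.
Qed.

Lemma kc_cost_img_eq0 (C Z : seq 'cV[R]_d) : C != [::] -> {subset C <= P} ->
  {subset Z <= P} -> kc_cost GP (img A C) (img A Z) <= 0 -> kc_cost P C Z <= 0.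
Proof.
move=> C0 CP ZP cost0; apply: kc_cost_le => // x xP xZ.
have AC0 : img A C != [::] by case: (C) C0.
have [||_ /mapP[c cC ->] xc] := kc_cost_cover GP (img A C) (img A Z) (A *m x) AC0.
- exact: map_f.
- by rewrite mem_img.
have : A *m x == A *m c by rewrite -edist_eq0 eq_le edist_ge0 (le_trans xc).
move=> /eqP/injA xcE; rewrite xcE// ?(CP _ cC)//.
by rewrite -[leRHS](edistxx c) mindist_le.
Qed.

Variables (e : R) (Cs Zs N : seq 'cV[R]_d).
Local Notation o := (opt_outliers P k z).
Hypotheses (e0 : 0 < e) (e1 : e <= 1 / 120) (o0 : 0 < o).
Hypotheses (sCs : size Cs = k) (uZs : uniq Zs) (ZsP : {subset Zs <= P})
  (sZs : (size Zs <= z)%N).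
Hypothesis Cs_cover : forall x, x \in P -> x \notin Zs ->
  exists2 c, c \in Cs & edist x c <= (1 + e) * o.
Hypothesis N_cover : forall x, x \in P ->
  exists2 s, s \in N & edist x s <= e * o /\ edist (A *m x) (A *m s) <= 9 * (e * o).
Hypothesis jlA : {in N ++ Cs &, forall x y,
  (1 - e) * edist x y <= edist (A *m x) (A *m y) <= (1 + e) * edist x y}.

(** A point reaches the image of its center through its net point, at cost at most (9 e + (1 + e) (1
    + 2 e)) o. The centers [Cs] must therefore be among the points whose distances are preserved. *)
Lemma opt_outliers_img_le : opt_outliers GP k z <= (1 + 20 * e) * o.
Proof.
move: (e0) (e1) (o0) => e0' e1' o0'.
apply: (opt_outliers_cover _ (img A Cs) (img A Zs)) => //.
- by rewrite size_map sCs.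
- exact: size_undup_img.
- exact: uniq_img.
- exact: img_sub.
- by rewrite size_map.
- by rewrite mulr_ge0 ?addr_ge0 ?mulr_ge0 ?(ltW e0) ?(ltW o0).
- move=> _ /mapP[x xP ->]; rewrite mem_img// => xZ.
  have [c cC xc] := Cs_cover x xP xZ.
  have [s sN [xs Axs]] := N_cover x xP.
  exists (A *m c); first exact: map_f.
  have /andP[_ sc] : (1 - e) * edist s c <= edist (A *m s) (A *m c) <= (1 + e) * edist s c.
    by apply: jlA; rewrite mem_cat ?sN ?cC ?orbT.
  have t1 := edist_triangle (A *m s) (A *m x) (A *m c).
  have t2 := edist_triangle x s c; rewrite (edistC s x) in t2.
  have sc' : edist s c <= (1 + 2 * e) * o by lra.
  have : (1 + e) * edist s c <= (1 + e) * ((1 + 2 * e) * o).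
    by rewrite ler_wpM2l// addr_ge0// ltW.
  have : 0 < e * o by exact: mulr_gt0.
  have : e * (e * o) <= 1 / 120 * (e * o) by rewrite ler_wpM2r// mulr_ge0 ?ltW.
  by lra.
Qed.

(* Kirszbraun applied to the inverse of [A] on the net points: it is
   [1/(1-e)]-Lipschitz, so a center of the image clustering pulls back. *)
Lemma opt_outliers_le_img : o <= (1 + 60 * e) * opt_outliers GP k z.
Proof.
move: (e0) (e1) (o0) => e0' e1' o0'.
have e60 : 0 < 1 + 60 * e by lra.
rewrite -ler_pdivrMl// mulrC.
apply: (le_opt_outliers _ _ _ _ size_undup_img) => C Z sC uZ ZGP sZ.
rewrite ler_pdivrMr//.
set c := kc_cost GP C Z; have c0 : 0 <= c by exact: kc_cost_ge0.
pose Z' := [seq x <- P | A *m x \in Z].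
(* If a center serves the image of [x], the image of the net point of [x] is within [rho] of it. *)
pose rho := c + 9 * (e * o).
have eo0 : 0 < e * o by exact: mulr_gt0.
have rho0 : 0 < rho by rewrite /rho; lra.
pose L := (1 - e)^-1.
have e10 : 0 < 1 - e by lra.
(* The factor [1 + e] supplies the strict inequality asked by [kirszbraun_ball]. *)
pose r := (1 + e) * (L * rho).
have L0 : 0 <= L by rewrite invr_ge0 ltW.
have Lrho0 : 0 < L * rho by rewrite mulr_gt0// invr_gt0.
have Lr : L * rho < r by rewrite /r mulrDl mul1r ltrDl mulr_gt0.
pose grp c' := [seq s <- N | edist (A *m s) c' <= rho].
have [f fP] : 
    {f : 'cV_t -> 'cV_d & forall c' s, s \in grp c' -> edist s (f c') <= r}.
  apply: (@choice _ _ (fun c' y => forall s, s \in grp c' -> edist s y <= r)) => c'.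
  have [||y yP] := kirszbraun_ball (fun i => A *m tnth (in_tuple (grp c')) i)
      (tnth (in_tuple (grp c'))) c' L rho r L0 (ltW rho0) Lr.
  - move=> i j; rewrite mulrC ler_pdivlMr// mulrC.
    have inN l : tnth (in_tuple (grp c')) l \in N ++ Cs.
      by have := mem_tnth l (in_tuple (grp c')); rewrite mem_filter mem_cat => /andP[_ ->].
    by have /andP[] := jlA _ _ (inN i) (inN j).
  - by move=> i; have := mem_tnth i (in_tuple (grp c')); rewrite mem_filter => /andP[].
  - exists y => s sg; have /tnthP[i ->] : s \in in_tuple (grp c') by [].
    exact: yP.
have C0 : C != [::] by rewrite -size_eq0 sC -lt0n.
have : o <= r + e * o.
  apply: (opt_outliers_cover _ (map f C) Z') => //.
  - by rewrite size_map sC.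
  - exact: size_undup_points.
  - exact: filter_uniq.
  - by move=> x; rewrite mem_filter => /andP[].
  - have Z'P : {subset Z' <= P} by move=> x; rewrite mem_filter => /andP[].
    rewrite -(size_map (mulmx A) Z'); apply: leq_trans sZ; apply: uniq_leq_size.
      by apply: uniq_img => //; exact: filter_uniq.
    by move=> _ /mapP[x + ->]; rewrite mem_filter => /andP[].
  - by rewrite addr_ge0 ?(ltW eo0)// (le_trans (ltW Lrho0))// ltW.
  - move=> x xP; rewrite mem_filter xP andbT => xZ.
    have [c' c'C xc'] := kc_cost_cover GP C Z (A *m x) C0 (map_f _ xP) xZ.
    have [s sN [xs Axs]] := N_cover x xP.
    exists (f c'); first exact: map_f.
    apply: (le_trans (edist_triangle s x _)); rewrite addrC lerD// fP// mem_filter sN andbT.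
    have := edist_triangle (A *m x) (A *m s) c'; rewrite (edistC (A *m s) (A *m x)) /rho -/c in xc' *.
    by lra.
have LE : (1 - e) * L = 1 by rewrite mulfV// gt_eqF.
have rE : (1 - e) * r = (1 + e) * rho by rewrite /r mulrCA (mulrA (1 - e)) LE mul1r.
move=> H; have : (1 - e) * o <= (1 + e) * rho + (1 - e) * (e * o).
  by rewrite -rE -mulrDr ler_pM2l.
rewrite /rho => H2.
have H3 : (1 - 11 * e - 8 * e ^+ 2) * o <= (1 + e) * c by move: H2; lra.
have ee : e ^+ 2 <= e / 120 by rewrite expr2 ler_pM2l//; lra.
have : (1 - 12 * e) * o <= (1 + e) * c.
  apply: le_trans H3; rewrite ler_pM2r//; lra.
have e12 : 0 < 1 - 12 * e by lra.
(* It remains that 1 + e <= (1 - 12 e) (1 + 60 e), which holds for e <= 1/120. *)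
move=> H4; rewrite -(ler_pM2l e12); apply: (le_trans H4).
by rewrite mulrC [leRHS]mulrCA ler_wpM2l//; lra.
Qed.

(** Here the centers are images of points of [P], so both a point and its center are replaced by net
    points and Kirszbraun is not involved. Since [alpha >= 1], the additive errors are absorbed into
    [alpha * o]. *)
Lemma kc_cost_pullback (alpha : R) (C Z : seq 'cV[R]_d) : 1 <= alpha ->
  C != [::] -> {subset C <= P} -> {subset Z <= P} ->
  kc_cost GP (img A C) (img A Z) <= alpha * opt_outliers GP k z ->
  kc_cost P C Z <= alpha * (1 + 60 * e) * o.
Proof.
move=> a1 C0 CP ZP cost.
move: (e0) (e1) (o0) => e0' e1' o0'.
have a0 : 0 < alpha by exact: lt_le_trans a1.
have eo0 : 0 < e * o by exact: mulr_gt0.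
apply: kc_cost_le => [|x xP xZ].
  by rewrite !mulr_ge0 ?(ltW a0) ?(ltW o0)//; lra.
have AC0 : img A C != [::] by case: (C) C0.
have [||_ /mapP[c cC ->] xc] := kc_cost_cover GP (img A C) (img A Z) (A *m x) AC0.
- exact: map_f.
- by rewrite mem_img.
apply: (le_trans (mindist_le x c C cC)).
have [s sN [xs Axs]] := N_cover x xP.
have [s' s'N [cs' Acs']] := N_cover c (CP _ cC).
have /andP[ss' _] : (1 - e) * edist s s' <= edist (A *m s) (A *m s') <= (1 + e) * edist s s'.
  by apply: jlA; rewrite mem_cat ?sN ?s'N.
have t1 := edist_triangle s x c; have t2 := edist_triangle s' s c.
have t3 := edist_triangle (A *m x) (A *m s) (A *m s').
have t4 := edist_triangle (A *m c) (A *m x) (A *m s').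
rewrite (edistC s' c) in t2; rewrite (edistC (A *m s) (A *m x)) in t3.
have xc' : edist (A *m x) (A *m c) <= alpha * ((1 + 20 * e) * o).
  apply: (le_trans xc); apply: (le_trans cost).
  by rewrite ler_wpM2l ?(ltW a0)// opt_outliers_img_le.
have eoa : e * o <= alpha * (e * o) by rewrite ler_peMl// ltW.
have e10 : 0 < 1 - e by lra.
rewrite -(ler_pM2l e10).
have H : (1 - e) * edist x c <= (1 - e) * (2 * (e * o)) + edist (A *m s) (A *m s').
  apply: (@le_trans _ _ ((1 - e) * (2 * (e * o) + edist s s'))); last lra.
  by rewrite ler_pM2l//; lra.
apply: (le_trans H).
(* 38 = 20 + 9 + 9: the bound on the image optimum and the image displacements at both ends. The two
   displacements in [P] then raise it to 40. *)
have H5 : edist (A *m s) (A *m s') <= alpha * ((1 + 38 * e) * o) by lra.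
apply: (@le_trans _ _ (alpha * ((1 + 40 * e) * o))).
  have : e * (e * o) >= 0 by rewrite mulr_ge0 ?ltW.
  by lra.
rewrite (_ : (1 - e) * _ = alpha * ((1 - e) * (1 + 60 * e) * o)); last by ring.
rewrite ler_pM2l// ler_wpM2r ?(ltW o0)//.
have : e * e <= e / 120 by rewrite ler_pM2l//; lra.
by lra.
Qed.

End transfer.

(** * Doubling nets and chaining *)

Section small_events.
Context {R : realType} {d0} {Omega : measurableType d0} (Pr : probability Omega R).
Implicit Types (E F : set Omega) (p q : R).

(* An outer-measure bound: the bad events below need not be shown measurable. *)
Definition small_event E p :=
  exists2 A, measurable A & E `<=` A /\ (Pr A <= p%:E)%E.

Lemma small_eventS E F p q : E `<=` F -> p <= q -> small_event F p -> small_event E q.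
Proof.
move=> EF pq [A mA [FA PA]]; exists A => //; split; first exact: subset_trans FA.
by apply: le_trans PA _; rewrite lee_fin.
Qed.

Lemma small_event0 p : 0 <= p -> small_event set0 p.
Proof. by move=> p0; exists set0 => //; split; rewrite ?measure0 ?lee_fin. Qed.

Lemma small_eventU E F p q : small_event E p -> small_event F q ->
  small_event (E `|` F) (p + q).
Proof.
move=> [A mA [EA PA]] [B mB [FB PB]]; exists (A `|` B); first exact: measurableU.
split; first exact: setUSS.
rewrite EFinD; apply: le_trans (leeD PA PB); exact: measureU2.
Qed.

Lemma small_event_bigU {I : eqType} (s : seq I) (F : I -> set Omega) p :
  (forall i, i \in s -> small_event (F i) p) ->
  small_event [set w | exists2 i, i \in s & F i w] ((size s)%:R * p).
Proof.
elim: s => [|i s IH] Fp.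
  by rewrite mul0r; apply: small_eventS (small_event0 _ (lexx 0)) => // w [].
have : small_event (F i `|` [set w | exists2 i, i \in s & F i w]) (p + (size s)%:R * p).
  apply: small_eventU; first by apply: Fp; rewrite inE eqxx.
  by apply: IH => j js; apply: Fp; rewrite inE js orbT.
apply: small_eventS => /=.
  by move=> w [j]; rewrite inE => /predU1P[->|js] Fj; [left|right; exists j].
by rewrite -[in leRHS]addn1 natrD mulrDl mul1r addrC.
Qed.

End small_events.

Section doubling.
Context {R : realType} {m : nat}.
Implicit Types (P S : seq 'cV[R]_m) (D : R).

Lemma ddim_approx P (delta : R) : 0 < delta ->
  exists D, [/\ 0 <= D, D < ddim P + delta & doubling_bound P D].
Proof.
move=> d0; have : has_inf [set D : R | 0 <= D /\ doubling_bound P D].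
  split; last by exists 0 => D [].
  (* All of [P] is a cover, and |P| <= 2^|P|. *)
  exists (size P)%:R; split; first by rewrite ler0n.
  move=> x r xP r0; exists P; split => //.
    by rewrite powR_mulrn// -natrX ler_nat ltnW// ltn_expl.
  by move=> y yP _; exists y => //; rewrite edistxx divr_ge0 ?ltW.
by move=> /(inf_adherent d0)[D [D0 dD] lt]; exists D.
Qed.

Lemma ddim_ge0 P : 0 <= ddim P.
Proof.
have [D [D0 _ dD]] := ddim_approx P 1 ltr01.
by apply: lb_le_inf => [|_ []//]; exists D.
Qed.

Lemma size_flatten_le {I T : eqType} (s : seq I) (f : I -> seq T) (b : R) :
  (forall i, i \in s -> (size (f i))%:R <= b) ->
  (size (flatten (map f s)))%:R <= (size s)%:R * b.
Proof.
elim: s => [|i s IH] fb; first by rewrite mul0r.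
rewrite /= size_cat natrD -[in leRHS]add1n natrD mulrDl mul1r lerD//.
  by apply: fb; rewrite inE eqxx.
by apply: IH => j js; apply: fb; rewrite inE js orbT.
Qed.

Lemma doubling_net P D (x : 'cV[R]_m) (r : R) (l : nat) : doubling_bound P D ->
  x \in P -> 0 < r ->
  exists S, [/\ {subset S <= P}, (size S)%:R <= (2 `^ D) ^+ l &
    forall y, y \in P -> edist y x <= r ->
      exists2 s, s \in S & edist y s <= r / 2 ^+ l].
Proof.
move=> dP xP r0; elim: l => [|l [S [SP sS covS]]].
  exists [:: x]; split => [y|//|y yP yx]; first by rewrite inE => /eqP ->.
  by exists x; rewrite ?inE// divr1.
have rl0 : 0 < r / 2 ^+ l by rewrite divr_gt0// exprn_gt0.
have [f fP] : {f : 'cV[R]_m -> seq 'cV[R]_m & forall s, s \in P ->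
    [/\ {subset f s <= P}, (size (f s))%:R <= 2 `^ D &
      forall y, y \in P -> edist y s <= r / 2 ^+ l ->
        exists2 q, q \in f s & edist y q <= r / 2 ^+ l / 2]}.
  apply: (@choice _ _ (fun s T => s \in P -> [/\ {subset T <= P},
    (size T)%:R <= 2 `^ D & forall y, y \in P -> edist y s <= r / 2 ^+ l ->
        exists2 q, q \in T & edist y q <= r / 2 ^+ l / 2])) => s.
  have [sP|sP] := boolP (s \in P); last by exists [::].
  by have [T HT] := dP s (r / 2 ^+ l) sP rl0; exists T.
exists (flatten (map f S)); split.
- move=> q /flattenP[_ /mapP[s sS' ->] qs].
  by have [fs _ _] := fP s (SP _ sS'); exact: fs.
- rewrite exprSr; apply: le_trans (_ : (size S)%:R * 2 `^ D <= _).
    by apply: size_flatten_le => s sS'; have [] := fP s (SP _ sS').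
  by rewrite ler_wpM2r// powR_ge0.
- move=> y yP yx; have [s sS' ys] := covS y yP yx.
  have [_ _ /(_ y yP ys)[q qs yq]] := fP s (SP _ sS').
  exists q; last by rewrite exprSr invfM mulrA.
  by apply/flattenP; exists (f s) => //; exact: map_f.
Qed.

Lemma powR2_le_expR D : 0 <= D -> 2 `^ D <= expR D.
Proof.
move=> D0; rewrite /powR ifF; last by rewrite gt_eqF.
rewrite ler_expR ler_piMr// -ler_expR lnK ?posrE//.
by have := @expR_ge1Dx R 1; rewrite (_ : 1 + 1 = 2)//.
Qed.

End doubling.

Section random_matrix.
Context {R : realType} {d0} {Omega : measurableType d0} (Pr : probability Omega R).
Context {t d : nat} (G : 'I_t -> 'I_d -> Omega -> R) (P : seq 'cV[R]_d).
Hypothesis t0 : (0 < t)%N.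
Hypothesis iidG : iid_gaussian_matrix Pr G.

Local Notation A := (Gmat G).

(** The displacement is compared with the radius, not with the distance to [s]; this is what
    chaining can bound without counting points of [P]. *)
Definition dilated_near (s : 'cV[R]_d) (rho K : R) : set Omega :=
  [set w | exists2 x, x \in P &
    edist x s <= rho /\ K * rho < edist (A w *m x) (A w *m s)].

(* Chaining: pass from [s] to a net point at scale [rho/2], whose image moves by at
   most [3 y rho], and continue from there with [y] replaced by [4/3 y], so that the
   remaining displacement is at most [6 y rho]. *)
Lemma chaining (D y : R) (s : 'cV[R]_d) (rho : R) : 0 <= D ->
  doubling_bound P D -> 6 * (D + 1) <= t%:R -> s \in P -> 0 < rho -> 1 <= y ->
  small_event Pr (dilated_near s rho (9 * y)) (expR (- (t%:R * y ^+ 2 / 4))).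
Proof.
move=> D0 dP tD sP rho0 y1; have [delta delta0 sepP] := exists_separation P.
(* Induction on the number of halvings that bring [rho] below the separation of [P], where [s] alone
   is left. *)
have [n rhon] : exists n : nat, rho < 2 ^+ n * delta.
  exists (Num.bound (rho / delta)); rewrite -ltr_pdivrMr//.
  apply: (lt_le_trans (archi_boundP _)); first by rewrite divr_ge0 ?ltW.
  by rewrite -natrX ler_nat ltnW// ltn_expl.
elim: n s rho y sP rho0 y1 rhon => [|n IH] s rho y sP rho0 y1 rhon.
  apply: small_eventS (small_event0 _ _ (expR_ge0 _)) => //.
  move=> w [x xP [xs]]; rewrite (sepP x s xP sP) ?edistxx.
    by rewrite ltNge !mulr_ge0// ?(ltW rho0)// (le_trans ler01).
  by apply: (le_lt_trans xs); rewrite mul1r in rhon.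
have y0 : 0 < y by apply: lt_le_trans y1.
have [S [SP sS cov]] := dP s rho sP rho0.
pose F q := [set w | ((1 + y) * enorm (q - s) < enorm (A w *m (q - s)))%R] `|`
  dilated_near q (rho / 2) (9 * (4 / 3 * y)).
pose b := expR (- (t%:R * y ^+ 2 / 2)) + expR (- (t%:R * (4 / 3 * y) ^+ 2 / 4)).
have FS q : q \in S -> small_event Pr (F q) b.
  move=> qS; apply: small_eventU.
    exists [set w | ((1 + y) * enorm (q - s) < enorm (A w *m (q - s)))%R].
      by apply: (measurable_enorm_gt Pr).
    by split => //; apply: gaussian_upper_tail.
  apply: IH; [exact: SP|by rewrite divr_gt0|lra|].
  by rewrite exprS in rhon; rewrite ltr_pdivrMr//; lra.
apply: small_eventS (small_event_bigU _ _ _ _ FS).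
  move=> w [x xP [xs lt]]; have [q qS xq] := cov x xP xs.
  exists q => //; have [qs|qs] := ltP ((1 + y) * enorm (q - s)) (enorm (A w *m (q - s))).
    by left.
  right; exists x => //; split => //.
  rewrite -!/(edist _ _) -edist_img in qs.
  have t1 := edist_triangle (A w *m q) (A w *m x) (A w *m s).
  have t2 := edist_triangle x q s; rewrite (edistC q x) in t2.
  have qs' : edist q s <= 3 / 2 * rho by lra.
  have : (1 + y) * edist q s <= (1 + y) * (3 / 2 * rho) by rewrite ler_pM2l//; lra.
  have : rho <= y * rho by rewrite ler_peMl// ltW.
  by lra.
have tR0 : 0 <= t%:R :> R by rewrite ler0n.
have y2 : 1 <= y ^+ 2 by rewrite exprn_ege1.
have ty : t%:R <= t%:R * y ^+ 2 by rewrite ler_peMr.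
(* (4/3)^2 / 4 = 4/9 <= 1/2 bounds both terms. The surplus 4/9 - 1/4 = 7/36 exceeds 1/6, so
   [6 * (D + 1) <= t] pays for the net points and the factor [expR 1]. *)
have b_le : b <= expR 1 * expR (- (4 / 9 * (t%:R * y ^+ 2))).
  apply: (@le_trans _ _ (2 * expR (- (4 / 9 * (t%:R * y ^+ 2))))).
    have := le_trans tR0 ty => ty0.
    by rewrite mulr_natl mulr2n; apply: lerD; rewrite ler_expR; lra.
  rewrite ler_wpM2r ?expR_ge0//; have := @expR_ge1Dx R 1; lra.
apply: (@le_trans _ _ (expR D * (expR 1 * expR (- (4 / 9 * (t%:R * y ^+ 2)))))).
  apply: ler_pM => //; first by rewrite addr_ge0 ?expR_ge0.
  by apply: (le_trans sS); exact: powR2_le_expR.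
by rewrite -!expRD ler_expR; lra.
Qed.

Lemma jl_pairs (e : R) (S : seq 'cV[R]_d) : 0 < e -> e < 1 ->
  small_event Pr [set w | exists2 x, x \in S & exists2 y, y \in S &
     ~~ ((1 - e) * edist x y <= edist (A w *m x) (A w *m y) <= (1 + e) * edist x y)]
   ((size S)%:R * ((size S)%:R * (2 * expR (- (t%:R * e ^+ 2 / 2))))).
Proof.
move=> e0 e1; apply: small_event_bigU => x _; apply: small_event_bigU => y _.
rewrite mulr_natl mulr2n.
apply: (small_eventS _ _ ([set w | (enorm (A w *m (x - y)) < (1 - e) * enorm (x - y))%R] `|`
  [set w | ((1 + e) * enorm (x - y) < enorm (A w *m (x - y)))%R])); last first.
- apply: small_eventU; (eexists; last by split; [exact: subset_refl|
    first [by apply: gaussian_lower_tail|by apply: gaussian_upper_tail]]).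
    by apply: (measurable_enorm_lt Pr).
  by apply: (measurable_enorm_gt Pr).
- exact: lexx.
- by move=> w /=; rewrite edist_img negb_and -!ltNge => /orP.
Qed.

(** The only union bound over all of [P]. It does not affect [t], because each pair contributes an
    arbitrarily small probability. *)
Lemma not_injective_small (delta : R) : 0 < delta ->
  small_event Pr [set w | ~ {in P &, injective (mulmx (A w) : 'cV[R]_d -> 'cV[R]_t)}] delta.
Proof.
move=> delta0; pose n : R := (size P).+1%:R.
have n0 : 0 < n by rewrite ltr0n.
apply: (small_eventS _ _ [set w | exists2 x, x \in P & exists2 y, y \in P &
    x != y /\ A w *m (x - y) = 0]
  ((size P)%:R * ((size P)%:R * (delta / n / n)))).
- move=> w /= inj; apply: contra_notP inj => H x y xP yP xy.
  apply/eqP; apply: contra_notT H => xny; exists x => //; exists y => //; split=> //.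
  by rewrite mulmxBr xy subrr.
- have nP : (size P)%:R <= n by rewrite ler_nat.
  apply: (@le_trans _ _ (n * (n * (delta / n / n)))); last first.
    by rewrite le_eqVlt; apply/orP; left; apply/eqP; field; rewrite gt_eqF.
  have dn0 : 0 <= delta / n / n by rewrite !divr_ge0 ?(ltW n0) ?(ltW delta0).
  by apply: ler_pM => //; [rewrite mulr_ge0|rewrite ler_wpM2r].
- apply: small_event_bigU => x _; apply: small_event_bigU => y _.
  have [->|xy] := eqVneq x y.
    apply: (small_eventS _ _ set0 0) => [w []//||]; last exact: small_event0.
    by rewrite !divr_ge0 ?(ltW n0) ?(ltW delta0).
  exists [set w | A w *m (x - y) = 0]; last first.
    split; first by move=> w [].
    by apply: gaussian_ker => //; rewrite ?subr_eq0// !divr_gt0.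
  by apply: (measurable_Gmat_ker Pr).
Qed.

End random_matrix.

(** * Constants, the net of P and the final union bound *)

Section constants.
Context {R : realType}.

Lemma ln2_ge : 1 / 2 <= ln 2 :> R.
Proof.
rewrite -ler_expR lnK ?posrE//.
have := @expR_ge1Dx R (- (1 / 2)); rewrite expRN => h.
have e0 : 0 < expR (1 / 2) :> R := expR_gt0 _.
have : (1 / 2) * expR (1 / 2) <= (expR (1 / 2))^-1 * expR (1 / 2) :> R.
  by rewrite ler_pM2r//; lra.
by rewrite mulVf ?gt_eqF//; lra.
Qed.

(** Each of the three bad events is allotted 1/9, for a total of 1/3. *)
Lemma expRN8_le : expR (- 8) <= 1 / 9 :> R.
Proof.
rewrite expRN div1r lef_pV2 ?posrE ?expR_gt0//.
by have := @expR_ge1Dx R 8; lra.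
Qed.

(** [l] halvings shrink the radius 2 (1 + e) o to e o when e = eps / 60. Minimality of [l] gives 2^l
    <= 244 / eps, and 244 <= 2^8 <= (1 / eps)^8. *)
Lemma net_depth (eps : R) : 0 < eps -> eps < 1 / 2 ->
  exists l : nat, 122 / eps <= 2 ^+ l /\ l%:R * ln 2 <= 9 * ln (1 / eps).
Proof.
move=> e0 e1.
have ex : exists l : nat, 122 / eps <= 2 ^+ l.
  exists (Num.bound (122 / eps)); apply: ltW.
  apply: (lt_le_trans (archi_boundP _)); first by rewrite divr_ge0 ?ltW.
  by rewrite -natrX ler_nat ltnW// ltn_expl.
have [l lP lmin] := ex_minnP ex.
exists l; split=> //.
have inv2 : 2 <= 1 / eps by rewrite ler_pdivlMr//; lra.
have inv0 : 0 < 1 / eps by lra.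
have le244 : 244 * (1 / eps) <= (1 / eps) ^+ 9.
  rewrite (exprSr _ 8) ler_pM2r//.
  apply: (@le_trans _ _ (2 ^+ 8)); last by rewrite lerXn2r ?nnegrE ?(ltW inv0).
  by rewrite -natrX ler_nat.
have l9 : 2 ^+ l <= (1 / eps) ^+ 9.
  apply: le_trans le244.
  case: l lP lmin => [|l] lP lmin; first by lra.
  have : ~~ (122 / eps <= 2 ^+ l).
    by apply/negP => /lmin; rewrite ltnn.
  rewrite -ltNge exprS; lra.
rewrite mulr_natl -lnXn// mulr_natl -lnXn//.
by rewrite ler_ln ?posrE ?exprn_gt0.
Qed.

End constants.

Lemma small_event_compl {R : realType} {d0} {Omega : measurableType d0}
    (Pr : probability Omega R) (F : set Omega) (p : R) : small_event Pr F p ->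
  exists E : set Omega, [/\ measurable E, ((1 - p)%:E <= Pr E)%E & E `<=` ~` F].
Proof.
move=> [A mA [FA PA]]; exists (~` A); split; first exact: measurableC.
  by rewrite probability_setC// EFinB leeB.
exact: subsetC.
Qed.

Lemma exists_net {R : realType} {d : nat} (P : seq 'cV[R]_d) (k z : nat)
    (eps e o : R) (Cs Zs : seq 'cV[R]_d) :
  (0 < k)%N -> 0 < eps -> eps < 1 / 2 -> e = eps / 60 -> 0 < o ->
  size Cs = k -> {subset Zs <= P} -> (size Zs <= z)%N ->
  (forall x, x \in P -> x \notin Zs -> exists2 c, c \in Cs & edist x c <= (1 + e) * o) ->
  exists N, [/\ {subset N <= P},
    (size (N ++ Cs))%:R <=
      expR (ln (k * z.+1).+1%:R + 9 * (ln (1 / eps) * ddim P) + 2) &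
    forall x, x \in P -> exists2 s, s \in N & edist x s <= e * o].
Proof.
move=> k0 eps0 eps1 eE o0 sCs ZsP sZs cover.
have e0 : 0 < e by rewrite eE divr_gt0.
have L2 : ln 2 <= ln (1 / eps) :> R.
  rewrite ler_ln ?posrE ?divr_gt0// ler_pdivlMr//; lra.
have Lpos : 0 < ln (1 / eps) by have := @ln2_ge R; lra.
set L := ln (1 / eps) in L2 Lpos *.
(* The surplus of [D] over [ddim P] gets multiplied by [l * ln 2 <= 9 * L], which costs the [+ 1] in
   [M]. *)
have d9 : 0 < 1 / (9 * L) by rewrite divr_gt0// mulr_gt0.
have [D [D0 Dlt dP]] := ddim_approx P _ d9.
have [l [lP lL]] := net_depth eps eps0 eps1.
pose M := expR (9 * (L * ddim P) + 1).
have DM : (2 `^ D) ^+ l <= M.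
  rewrite /powR ifF; last by rewrite gt_eqF.
  rewrite -expRM_natl ler_expR.
  have : D * (l%:R * ln 2) <= D * (9 * L) by rewrite ler_wpM2l.
  have : D * (9 * L) <= (ddim P + 1 / (9 * L)) * (9 * L).
    by rewrite ler_wpM2r ?(ltW Dlt)// mulr_ge0// ltW.
  have -> : (ddim P + 1 / (9 * L)) * (9 * L) = 9 * (L * ddim P) + 1.
    by field; rewrite gt_eqF.
  by lra.
(* Centers need not lie in [P], but doubling concerns balls around points of [P]: the ball is
   recentered at one of its points, at twice the radius. *)
have r0 : 0 < 2 * ((1 + e) * o) by rewrite !mulr_gt0// addr_gt0.
have [f fP] : {f : 'cV[R]_d -> seq 'cV[R]_d & forall c,
    [/\ {subset f c <= P}, (size (f c))%:R <= M &
      forall x, x \in P -> edist x c <= (1 + e) * o ->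
        exists2 s, s \in f c & edist x s <= e * o]}.
  apply: (@choice _ _ (fun c T => [/\ {subset T <= P}, (size T)%:R <= M &
      forall x, x \in P -> edist x c <= (1 + e) * o ->
        exists2 s, s \in T & edist x s <= e * o])) => c.
  have [/hasP[x0 x0P x0c]|/hasPn nox] :=
      boolP (has (fun x => edist x c <= (1 + e) * o) P); last first.
    exists [::]; split => //; first by rewrite expR_ge0.
    by move=> x /nox /negbTE ->.
  have [S [SP sS cov]] := doubling_net P D x0 _ l dP x0P r0.
  exists S; split=> //; first exact: le_trans DM.
  move=> x xP xc; have [|s sS' xs] := cov x xP.
    have := edist_triangle c x x0; rewrite (edistC c x0) => t1.
    by apply: (le_trans t1); lra.
  exists s => //; apply: (le_trans xs); rewrite ler_pdivrMr ?exprn_gt0//.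
  apply: (@le_trans _ _ (e * o * (122 / eps))); last first.
    by rewrite ler_pM2l// mulr_gt0.
  have -> : e * o * (122 / eps) = (122 / 60) * o by rewrite eE; field; rewrite gt_eqF.
  by rewrite mulrA ler_pM2r//; lra.
exists (Zs ++ flatten (map f Cs)); split.
- move=> x; rewrite mem_cat => /orP[/ZsP//|/flattenP[_ /mapP[c _ ->] xf]].
  by have [fc _ _] := fP c; exact: fc.
- rewrite !size_cat !natrD.
  have sF : (size (flatten (map f Cs)))%:R <= k%:R * M.
    by rewrite -sCs; apply: size_flatten_le => c _; have [] := fP c.
  set K : R := _.+1%:R.
  have K0 : 0 < K by rewrite ltr0n.
  have M1 : 1 <= M.
    rewrite -[leLHS]expR0 ler_expR; have := mulr_ge0 (ltW Lpos) (ddim_ge0 P); lra.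
  have kK : k%:R <= K by rewrite ler_nat ltnW// ltnS leq_pmulr.
  have zkK : z%:R + k%:R <= K.
    by rewrite -natrD ler_nat ltnW// ltnS mulnS addnC leq_add2l leq_pmull.
  have zsz : (size Zs)%:R <= z%:R :> R by rewrite ler_nat.
  have kM : k%:R * M <= K * M by rewrite ler_wpM2r// (le_trans ler01).
  have KM : K <= K * M by rewrite ler_peMr// ltW.
  (* Outliers, nets and centers number at most z + k M + k <= 2 K M; bounding 2 by [expR 1] gives
     the second unit of the [+ 2]. *)
  apply: (@le_trans _ _ (2 * (K * M))); first by rewrite sCs; lra.
  apply: (@le_trans _ _ (expR 1 * (K * M))).
    rewrite ler_pM2r ?mulr_gt0 ?expR_gt0//.
    by have := @expR_ge1Dx R 1; lra.
  rewrite -{1}(lnK (x := K)) ?posrE// -!expRD ler_expR; lra.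
- move=> x xP; have [xZ|xZ] := boolP (x \in Zs).
    by exists x; rewrite ?mem_cat ?xZ// edistxx mulr_ge0 ?ltW.
  have [c cC xc] := cover x xP xZ; have [_ _ /(_ x xP xc)[s sf xs]] := fP c.
  exists s => //; rewrite mem_cat; apply/orP; right.
  by apply/flattenP; exists (f c) => //; exact: map_f.
Qed.

Theorem theorem5p2 (R : realType) :
  exists c : R, 0 < c /\
  forall (d : nat) (P : seq 'cV[R]_d) (k z : nat) (eps : R) (t : nat)
         (dsp : measure_display) (Omega : measurableType dsp)
         (Pr : probability Omega R) (G : 'I_t -> 'I_d -> Omega -> R),
    uniq P -> (0 < k)%N -> (k <= size P)%N -> (z < size P)%N ->
    0 < eps -> eps < 1 / 2 ->
    c * (ln ((k * z.+1).+1)%:R / eps ^+ 2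
         + ln (1 / eps) / eps ^+ 2 * ddim P) <= t%:R ->
    iid_gaussian_matrix Pr G ->
    exists E : set Omega, [/\ measurable E, ((2 / 3)%:E <= Pr E)%E &
      forall w, E w ->
        let GP := img (Gmat G w) P in
        (* (1) the optimal values agree up to a factor 1 + eps *)
        [/\ opt_outliers GP k z <= (1 + eps) * opt_outliers P k z,
            opt_outliers P k z <= (1 + eps) * opt_outliers GP k z &
        (* (2) approximate solutions pull back *)
            forall (alpha : R) (C Z : seq 'cV[R]_d), 1 <= alpha ->
              uniq C -> size C = k -> {subset C <= P} ->
              uniq Z -> (size Z <= z)%N -> {subset Z <= P} ->
              is_approx GP k z alpha (img (Gmat G w) C) (img (Gmat G w) Z) ->
              is_approx P k z (alpha * (1 + eps)) C Z]].
Proof.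
(* The demanding event is distance preservation at precision eps / 60: t eps^2 / 7200 must exceed 2
   Lam + 18 h + 13, where Lam >= 1/2. *)
exists (500 * 500); split; first by rewrite mulr_gt0 ?ltr0n.
move=> d P k z eps t dsp Omega Pr G uP k0 kP zP e0 e1 t_large iidG.
have kP' : (k <= size (undup P))%N by rewrite undup_id.
pose Lam : R := ln (k * z.+1).+1%:R.
pose h : R := ln (1 / eps) * ddim P.
(* The successors keep the logarithm at least [ln 2] even for k = 1 and z = 0, so it dominates
   additive constants. *)
have Lam1 : 1 / 2 <= Lam.
  apply: (le_trans ln2_ge); rewrite ler_ln ?posrE ?ltr0n// ler_nat.
  by rewrite ltnS muln_gt0 k0.
have Leps : ln 2 <= ln (1 / eps) :> R.
  by rewrite ler_ln ?posrE ?divr_gt0// ler_pdivlMr//; lra.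
have Leps1 : 1 / 2 <= ln (1 / eps) := le_trans ln2_ge Leps.
have D0 := ddim_ge0 P.
have h0 : 0 <= h by rewrite mulr_ge0//; lra.
have e20 : 0 < eps ^+ 2 by rewrite exprn_gt0.
have te : 500 * 500 * (Lam + h) <= t%:R * eps ^+ 2.
  rewrite -ler_pdivrMr//; apply: le_trans t_large.
  by rewrite -/Lam [_ / _ * ddim P]mulrAC -/h -mulrDl mulrA.
have t_ge : 500 * 500 * (Lam + h) <= t%:R.
  apply: (le_trans te); rewrite ler_piMr// expr2.
  by have : eps * eps <= 1 * eps; [rewrite ler_pM2r//; lra|lra].
have t0 : (0 < t)%N by rewrite -(ltr0n R); lra.
have C_neq0 (C : seq 'cV[R]_d) : size C = k -> C != [::].
  by move=> sC; rewrite -size_eq0 sC -lt0n.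
have o_ge0 := opt_outliers_ge0 P k z kP'.
have [opos|opt_neq0] := eqVneq (opt_outliers P k z) 0.
  have [E [mE PE Einj]] := small_event_compl Pr _ _
    (not_injective_small Pr G P t0 iidG (1 / 3) (divr_gt0 ltr01 (ltr0n R 3))).
  exists E; split => //; first by apply: le_trans PE; rewrite lee_fin; lra.
  move=> w /Einj /= /contrapT inj.
  have GP0 := opt_outliers_img_eq0 (Gmat G w) P k z uP k0 kP inj opos.
  rewrite GP0 opos !mulr0; split=> // alpha C Z _ _ sC CP _ _ ZP.
  rewrite /is_approx GP0 opos !mulr0.
  by apply: kc_cost_img_eq0 => //; exact: C_neq0.
have opos : 0 < opt_outliers P k z by rewrite lt_neqAle eq_sym opt_neq0.
set o := opt_outliers P k z in opos.
(* Matches the factor [1 + 60 * e] lost in the transfer to and from the image. *)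
pose e := eps / 60.
have ee : 0 < e by rewrite divr_gt0.
have e120 : e <= 1 / 120 by rewrite /e; lra.
have [Cs [Zs [sCs uZs ZsP sZs cost]]] :=
  opt_outliers_approx P k z (e * o) kP' (mulr_gt0 ee opos).
have Cs_cover x : x \in P -> x \notin Zs -> exists2 c, c \in Cs & edist x c <= (1 + e) * o.
  move=> xP xZ; have [c cC xc] := kc_cost_cover P Cs Zs x (C_neq0 _ sCs) xP xZ.
  by exists c => //; rewrite mulrDl mul1r; apply: (le_trans xc); exact: ltW.
have [N [NP sN covN]] := exists_net P k z eps e o Cs Zs k0 e0 e1 erefl opos sCs ZsP sZs Cs_cover.
rewrite -/Lam -/h in sN; set B := expR _ in sN.
have eo0 : 0 < e * o by exact: mulr_gt0.
have [D [Dge0 Dlt dP]] := ddim_approx P (1 / 2) (divr_gt0 ltr01 (ltr0n R 2)).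
have tD : 6 * (D + 1) <= t%:R.
  have : (1 / 2) * ddim P <= h by rewrite ler_wpM2r.
  by lra.
have chain := small_event_bigU Pr N (fun s => dilated_near G P s (e * o) (9 * 1)) _
  (fun s sN => chaining Pr G P t0 iidG D 1 s (e * o) Dge0 dP tD (NP _ sN) eo0 (lexx 1)).
have e_lt1 : e < 1 by lra.
have jl := jl_pairs Pr G t0 iidG e (N ++ Cs) ee e_lt1.
have inj := not_injective_small Pr G P t0 iidG (1 / 9) (divr_gt0 ltr01 (ltr0n R 9)).
have sN' : (size N)%:R <= B.
  by apply: le_trans sN; rewrite ler_nat size_cat leq_addr.
have chain_small : (size N)%:R * expR (- (t%:R * 1 ^+ 2 / 4)) <= 1 / 9 :> R.
  apply: (@le_trans _ _ (B * expR (- (t%:R * 1 ^+ 2 / 4)))).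
    by rewrite ler_wpM2r ?expR_ge0.
  apply: le_trans expRN8_le; rewrite -expRD ler_expR expr1n; lra.
have jl_small : (size (N ++ Cs))%:R * ((size (N ++ Cs))%:R *
    (2 * expR (- (t%:R * e ^+ 2 / 2)))) <= 1 / 9 :> R.
  apply: (@le_trans _ _ (B * (B * (expR 1 * expR (- (t%:R * e ^+ 2 / 2)))))).
    have le2 : 2 * expR (- (t%:R * e ^+ 2 / 2)) <= expR 1 * expR (- (t%:R * e ^+ 2 / 2)).
      rewrite ler_pM2r ?expR_gt0//.
      by have := @expR_ge1Dx R 1; lra.
    have E0 : 0 <= 2 * expR (- (t%:R * e ^+ 2 / 2)) by rewrite mulr_ge0 ?expR_ge0.
    by apply: ler_pM => //; apply: ler_pM.
  apply: le_trans expRN8_le; rewrite -!expRD ler_expR.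
  have -> : t%:R * e ^+ 2 / 2 = t%:R * eps ^+ 2 / 7200 by rewrite /e; field.
  by lra.
have [E [mE PE EN]] := small_event_compl Pr _ _
  (small_eventU _ _ _ _ _ (small_eventU _ _ _ _ _ chain jl) inj).
exists E; split => //.
  by apply: le_trans PE; rewrite lee_fin; lra.
move=> w Ew; have := EN w Ew => /= /not_orP[/not_orP[near_w jl_w] /contrapT inj_w].
set A := Gmat G w in near_w jl_w inj_w *.
have N_cover x : x \in P -> exists2 s, s \in N & edist x s <= e * o /\
    edist (A *m x) (A *m s) <= 9 * (e * o).
  move=> xP; have [s sN1 xs] := covN x xP; exists s => //; split => //.
  rewrite leNgt; apply/negP => lt; apply: near_w; exists s => //; exists x => //.
  by rewrite mulr1.
have jlA : {in N ++ Cs &, forall x y,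
    (1 - e) * edist x y <= edist (A *m x) (A *m y) <= (1 + e) * edist x y}.
  move=> x y xN yN; apply/negPn/negP => H; apply: jl_w.
  by exists x => //; exists y.
have GPo : opt_outliers (img A P) k z <= (1 + eps) * o.
  apply: (le_trans (opt_outliers_img_le A P k z uP k0 kP inj_w e Cs Zs N
    ee e120 opos sCs uZs ZsP sZs Cs_cover N_cover jlA)).
  by rewrite ler_pM2r//; rewrite /e; lra.
split => //.
  have := opt_outliers_le_img A P k z uP k0 kP inj_w e Cs N ee e120 opos N_cover jlA.
  by rewrite (_ : 60 * e = eps)// /e; field.
move=> alpha C Z a1 _ sC CP _ _ ZP; rewrite /is_approx => costG.
have := kc_cost_pullback A P k z uP k0 kP inj_w e Cs Zs N ee e120 opos sCs uZs
  ZsP sZs Cs_cover N_cover jlA alpha C Z a1 (C_neq0 _ sC) CP ZP costG.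
by rewrite (_ : 60 * e = eps)// /e; field.
Qed.
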